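(* Let $n\geq 1$ and let $F\in\mathbb{C}[x_0,\ldots,x_n]_2$ be a general quadratic homogeneous polynomial in $n+1$ variables. Then the irreducible components of $VSP(F,h)$ are unirational for any $h$, and they are rational for $h=n+1$.
   Context: The base field is $\mathbb{C}$. $\mathbb{C}[x_0,\ldots,x_n]_d$ denotes the space of homogeneous polynomials of degree $d$. An unordered set of points $\{[L_1],\ldots,[L_h]\}\subset(\mathbb{P}^n)^*$, with $L_i\in\mathbb{C}[x_0,\ldots,x_n]_1$ linear forms, is a polar $h$-polyhedron of $F\in\mathbb{C}[x_0,\ldots,x_n]_d$ if $F=\lambda_1L_1^d+\cdots+\lambda_hL_h^d$ for some nonzero scalars $\lambda_1,\ldots,\lambda_h\in\mathbb{C}$ and the forms $L_1^d,\ldots,L_h^d$ are linearly independent in $\mathbb{C}[x_0,\ldots,x_n]_d$. $VSP(F,h)^o$ denotes the set of all polar $h$-polyhedra of $F$, regarded as a subset of the Hilbert scheme $\mathrm{Hilb}_h((\mathbb{P}^n)^* )$ of length $h$ zero-dimensional subschemes, and the Variety of Sums of Powers is its closure $VSP(F,h):=\overline{VSP(F,h)^o}\subseteq\mathrm{Hilb}_h((\mathbb{P}^n)^* )$. ''General'' means outside a proper Zariski closed subset of the parameter space. *)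

(* Defs.v *)
From HB Require Import structures.
From mathcomp Require Import all_boot all_order all_algebra.
From mathcomp Require Import boolp classical_sets.
From mathcomp Require Import mpoly.

Set Implicit Arguments.
Unset Strict Implicit.
Unset Printing Implicit Defensive.

Import GRing.Theory.
Local Open Scope ring_scope.
Local Open Scope classical_set_scope.

(** * Zariski topology and rational maps on projective spaces

    Varieties are given by their closed points over an algebraically closed
    field [K] and carry the reduced structure. *)

Definition polyfun (K : closedFieldType) (V : vectType K) : Type :=
  {mpoly K[\dim {:V}]}.

Definition peval (K : closedFieldType) (V : vectType K)
    (P : polyfun V) (v : V) : K :=
  P.@[fun i => coord (vbasis {:V}) i v].

Definition affine_closed (K : closedFieldType) (V : vectType K)
    (A : set V) : Prop :=
  exists I : set (polyfun V), A = [set v | forall P, I P -> peval P v = 0].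

Definition general (K : closedFieldType) (V : vectType K)
    (Q : V -> Prop) : Prop :=
  exists B : set V,
    [/\ affine_closed B, B <> setT & forall v, ~ B v -> Q v].

(* A point of P(V) is a line through the origin of V. *)
Definition proj (K : closedFieldType) (V : vectType K) : Type :=
  {l : {vspace V} | \dim l == 1%N}.

Definition proj_closed (K : closedFieldType) (V : vectType K)
    (A : set (proj V)) : Prop :=
  exists I : set (polyfun V),
    (forall P, I P -> exists d : nat, P \is d.-homog) /\
    A = [set x : proj V |
      forall P, I P -> forall v, v \in \val x -> peval P v = 0].

Definition proj_closure (K : closedFieldType) (V : vectType K)
    (A : set (proj V)) : set (proj V) :=
  [set x | forall B, proj_closed B -> A `<=` B -> B x].

Definition irreducible (K : closedFieldType) (V : vectType K)
    (X : set (proj V)) : Prop :=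
  X !=set0 /\
  forall A B, proj_closed A -> proj_closed B ->
    X `<=` A `|` B -> X `<=` A \/ X `<=` B.

Definition irreducible_component (K : closedFieldType) (V : vectType K)
    (X Y : set (proj V)) : Prop :=
  [/\ irreducible Y, Y `<=` X
    & forall Z, irreducible Z -> Y `<=` Z -> Z `<=` X -> Z = Y].

(* The coordinates of a map P(V) --> P(W): homogeneous polynomials of one
   common degree, which may vanish simultaneously at some points. *)
Record ratmap (K : closedFieldType) (V W : vectType K) := Ratmap {
  ratmap_deg : nat;
  ratmap_coord : 'I_(\dim {:W}) -> polyfun V;
  ratmap_homog : forall i, ratmap_coord i \is ratmap_deg.-homog
}.

Definition ratmap_eval (K : closedFieldType) (V W : vectType K)
    (f : ratmap V W) (v : V) : W :=
  \sum_i peval (ratmap_coord f i) v *: (vbasis {:W})`_i.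

(* [f] is defined at [x] and maps it to [y]. *)
Definition maps_to (K : closedFieldType) (V W : vectType K)
    (f : ratmap V W) (x : proj V) (y : proj W) : Prop :=
  exists v : V,
    [/\ v \in \val x, ratmap_eval f v != 0 & ratmap_eval f v \in \val y].

(* Complements of closed sets not containing [X] are the nonempty open subsets
   of [X]; they are dense since [X] and [Y] are meant to be irreducible, and on
   a small enough one every rational map is given by a single [ratmap]. *)
Definition dominates (K : closedFieldType) (V W : vectType K)
    (X : set (proj V)) (Y : set (proj W)) : Prop :=
  exists (f : ratmap V W) (A : set (proj V)),
    [/\ proj_closed A, ~ X `<=` A,
        forall x, X x -> ~ A x -> exists2 y, Y y & maps_to f x y
      & Y `<=` proj_closure [set y | exists x, [/\ X x, ~ A x & maps_to f x y]]].

(* Nonempty open subsets of [X] and [Y] are isomorphic. *)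
Definition birational (K : closedFieldType) (V W : vectType K)
    (X : set (proj V)) (Y : set (proj W)) : Prop :=
  exists (f : ratmap V W) (g : ratmap W V)
         (A : set (proj V)) (B : set (proj W)),
    [/\ proj_closed A /\ ~ X `<=` A,
        proj_closed B /\ ~ Y `<=` B,
        forall x, X x -> ~ A x ->
          exists y, [/\ Y y, ~ B y, maps_to f x y & maps_to g y x]
      & forall y, Y y -> ~ B y ->
          exists x, [/\ X x, ~ A x, maps_to g y x & maps_to f x y]].

Definition is_unirational (K : closedFieldType) (V : vectType K)
    (Y : set (proj V)) : Prop :=
  exists m : nat, dominates [set: proj 'rV[K]_m.+1] Y.

Definition is_rational (K : closedFieldType) (V : vectType K)
    (Y : set (proj V)) : Prop :=
  exists m : nat, birational [set: proj 'rV[K]_m.+1] Y.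

(** * The Hilbert scheme of points of the dual projective space *)

Definition forms (K : closedFieldType) (n d : nat) : vectType K :=
  dhomog n.+1 K d.

Definition dual_proj (K : closedFieldType) (n : nat) : Type :=
  proj (forms K n 1).

(* [p] is a polynomial in the coordinates [a_0, ..., a_n] of the linear form
   [a_0 x_0 + ... + a_n x_n]. *)
Definition eval_at_form (K : closedFieldType) (n : nat)
    (p : {mpoly K[n.+1]}) (L : forms K n 1) : K :=
  p.@[fun i => (L : dhomog n.+1 K 1)@_U_(i)].

Definition vanishing_ideal (K : closedFieldType) (n : nat)
    (Z : set (dual_proj K n)) : set {mpoly K[n.+1]} :=
  [set p | forall x, Z x -> forall L, L \in \val x -> eval_at_form p L = 0].

Definition saturated_homogeneous_ideal (K : closedFieldType) (n : nat)
    (I : set {mpoly K[n.+1]}) : Prop :=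
  [/\ I 0,
      forall p q, I p -> I q -> I (p + q),
      forall p q, I q -> I (p * q),
      forall p d, I p -> I (pihomog mdeg d p)
    & forall p, (exists k : nat, forall i : 'I_n.+1, I ('X_i ^+ k * p)) -> I p].

(* [a] identifies the degree [t] piece of the quotient by [I] with [K^h]. *)
Definition presents_piece (K : closedFieldType) (n t h : nat)
    (I : set {mpoly K[n.+1]}) (a : 'Hom(forms K n t, 'rV[K]_h)) : Prop :=
  limg a = fullv /\
  forall p : forms K n t, (p \in lker a) <-> I (p : dhomog n.+1 K t).

(* Closed subschemes of projective space correspond to saturated homogeneous
   ideals; those of dimension zero and length [h] are the ones whose Hilbert
   polynomial is the constant [h]. *)
Definition length_ideal (K : closedFieldType) (n h : nat)
    (I : set {mpoly K[n.+1]}) : Prop :=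
  saturated_homogeneous_ideal I /\
  exists t0 : nat, forall t : nat, (t0 <= t)%N ->
    exists a : 'Hom(forms K n t, 'rV[K]_h), presents_piece I a.

(* Plücker coordinates of the quotient [a] of V: all its h x h minors. The
   index families are not required to be increasing, which only repeats
   coordinates up to sign and adds zeros. *)
Definition plucker_space (K : closedFieldType) (V : vectType K) (h : nat) :
    vectType K :=
  {ffun {ffun 'I_h -> 'I_(\dim {:V})} -> K^o}.

Definition plucker (K : closedFieldType) (V : vectType K) (h : nat)
    (a : 'Hom(V, 'rV[K]_h)) : plucker_space V h :=
  [ffun J : {ffun 'I_h -> 'I_(\dim {:V})} =>
    \det (\matrix_(i < h, j < h) a (vbasis {:V})`_(J i) 0 j) : K^o].

(* The Gotzmann number of the constant Hilbert polynomial [h] is [h], so that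
   sending [I] to the quotient of the degree [h] forms by its degree [h] piece
   embeds the Hilbert scheme as a closed subscheme of the Grassmannian of
   [h]-dimensional quotients, itself embedded by its Plücker coordinates. *)
Definition hilb_space (K : closedFieldType) (n h : nat) : vectType K :=
  plucker_space (forms K n h) h.

Definition hilb_point (K : closedFieldType) (n h : nat)
    (I : set {mpoly K[n.+1]}) (z : proj (hilb_space K n h)) : Prop :=
  exists a : 'Hom(forms K n h, 'rV[K]_h),
    presents_piece I a /\ \val z = <[plucker a]>%VS.

Definition Hilb (K : closedFieldType) (n h : nat) :
    set (proj (hilb_space K n h)) :=
  [set z | exists I : set {mpoly K[n.+1]}, length_ideal h I /\ hilb_point I z].

Arguments Hilb : clear implicits.

(** * Varieties of sums of powers *)

Lemma form_pow_homog (K : closedFieldType) (n d : nat)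
    (L : dhomog n.+1 K 1) :
  (L : {mpoly K[n.+1]}) ^+ d \is d.-homog.
Proof. by have := dhomogMn d (dhomog_is_dhomog L); rewrite mul1n. Qed.

Definition form_pow (K : closedFieldType) (n : nat) (L : forms K n 1) (d : nat) :
    forms K n d :=
  DHomog (form_pow_homog d L).

Definition polar_polyhedron (K : closedFieldType) (n d h : nat)
    (F : forms K n d) (Z : set (dual_proj K n)) : Prop :=
  exists (L : 'I_h -> forms K n 1) (lambda : 'I_h -> K),
    [/\ forall i, L i != 0,
        Z = [set x | exists i, \val x = <[L i]>%VS],
        forall i, lambda i != 0,
        F = \sum_i lambda i *: form_pow (L i) d
      & free [tuple form_pow (L i) d | i < h]].

(* The polar polyhedra, as reduced subschemes, inside the Hilbert scheme. *)
Definition VSPo (K : closedFieldType) (n d : nat) (F : forms K n d) (h : nat) :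
    set (proj (hilb_space K n h)) :=
  [set z | exists Z : set (dual_proj K n),
     polar_polyhedron h F Z /\ hilb_point (vanishing_ideal Z) z].

Arguments VSPo {K n d} F h _.

(* The closure in the subspace topology of the Hilbert scheme. *)
Definition VSP (K : closedFieldType) (n d : nat) (F : forms K n d) (h : nat) :
    set (proj (hilb_space K n h)) :=
  Hilb K n h `&` proj_closure (VSPo F h).

Arguments VSP {K n d} F h _.

(* Main.v *)
(* A polar h-polyhedron of a nondegenerate quadric F with Gram matrix G is,
   after absorbing the scalars, an (n+1) x h matrix U with U U^T = G, whose
   columns are the forms L_i. By Witt's theorem U = A Q with A fixed and Q
   orthogonal, and after changing the signs of the columns, which does not
   change the polyhedron, Q is a Cayley transform (1 - S) (1 + S)^-1 with S
   skew. Hence the polyhedra are exactly the image of an open subset of a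
   projective space under a polynomial map, and VSP(F,h) is irreducible and
   unirational.

   For h = n + 1, fix one polar simplex B; the others are B R^T with R
   orthogonal. Let 1 = (1, ..., 1) and d = (1, 2, ..., n+1). A general frame
   R is encoded by the only symmetric matrix M diagonalized by R such
   that M 1 = d, and the symmetric matrices M with M 1 proportional to d
   form a linear space. Since x_k / (x_0 + ... + x_n) acts on the coordinate
   ring of the simplex as a polynomial in M, which is read off the Krylov
   matrix (1, M 1, M^2 1, ...), the Plücker coordinates of the simplex are
   polynomials in M; conversely M, being multiplication by (d . x) / (1 .
   x), is obtained from the Plücker coordinates by Cramer's rule. *)

Require Import Defs.
From HB Require Import structures.
From mathcomp Require Import all_boot all_order all_algebra fingroup perm.
From mathcomp Require Import boolp classical_sets reals complex.
From mathcomp Require Import mpoly ring zify.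

Set Implicit Arguments.
Unset Strict Implicit.
Unset Printing Implicit Defensive.

Import GRing.Theory.
Local Open Scope ring_scope.
Local Open Scope classical_set_scope.

(** * Homogeneous polynomial functions *)

Lemma homog_meval_scale (K : comNzRingType) n d (p : {mpoly K[n]}) : p \is d.-homog ->
  forall c u, p.@[fun i => c * u i] = c ^+ d * p.@[u].
Proof.
move=> hP c u; rewrite !mevalE mulr_sumr.
rewrite !big_seq; apply: eq_bigr => m mP.
have <- : mdeg m = d by exact: (dhomog_mf hP).
rewrite mulrCA; congr (_ * _); rewrite mdegE -prodrXr -big_split /=.
by apply: eq_bigr => i _; rewrite exprMn.
Qed.

(** Homogeneity is a predicate on functions, so that determinants, adjugates and matrix powers are
    handled by closure rules, without exhibiting a polynomial. *)
Definition hpoly (K : closedFieldType) (V : vectType K) (d : nat)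
    (phi : V -> K) : Prop :=
  exists2 P : polyfun V, P \is d.-homog & forall v, peval P v = phi v.

Section HPoly.
Variables (K : closedFieldType) (V : vectType K).
Implicit Types (d e : nat) (phi psi : V -> K).

Lemma eq_hpoly d phi psi : phi =1 psi -> hpoly d phi -> hpoly d psi.
Proof. by move=> E [P hP eP]; exists P => // v; rewrite eP E. Qed.

Lemma hpoly_deg d e phi : d = e -> hpoly d phi -> hpoly e phi.
Proof. by move=> ->. Qed.

Lemma hpoly0 d : hpoly d (fun _ : V => 0).
Proof. by exists 0 => [|v]; rewrite ?dhomog0 // /peval meval0. Qed.

Lemma hpoly_const c : hpoly 0 (fun _ : V => c).
Proof.
exists (c%:MP_[_]) => [|v]; last by rewrite /peval mevalC.
by rewrite -[c%:MP_[_]]mulr1 mul_mpolyC rpredZ // dhomog1.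
Qed.

Lemma hpolyD d phi psi :
  hpoly d phi -> hpoly d psi -> hpoly d (fun v => phi v + psi v).
Proof.
move=> [P hP eP] [Q hQ eQ]; exists (P + Q) => [|v]; first by rewrite rpredD.
by rewrite /peval mevalD -/(peval P v) -/(peval Q v) eP eQ.
Qed.

Lemma hpolyM d e phi psi :
  hpoly d phi -> hpoly e psi -> hpoly (d + e) (fun v => phi v * psi v).
Proof.
move=> [P hP eP] [Q hQ eQ]; exists (P * Q) => [|v]; first exact: dhomogM.
by rewrite /peval mevalM -/(peval P v) -/(peval Q v) eP eQ.
Qed.

Lemma hpolyZ d c phi : hpoly d phi -> hpoly d (fun v => c * phi v).
Proof. by move/(hpolyM (hpoly_const c)). Qed.

Lemma hpolyN d phi : hpoly d phi -> hpoly d (fun v => - phi v).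
Proof.
by move/(hpolyZ (-1)); apply: eq_hpoly => v /=; rewrite mulN1r.
Qed.

Lemma hpolyX d k phi : hpoly d phi -> hpoly (k * d) (fun v => phi v ^+ k).
Proof.
move=> h; elim: k => [|k IH].
  by apply: eq_hpoly (hpoly_const 1) => v; rewrite expr0.
by apply: eq_hpoly (hpolyM h IH) => v; rewrite exprS.
Qed.

Lemma hpoly_sum (I : Type) (r : seq I) (P : pred I) d (phi : I -> V -> K) :
  (forall i, P i -> hpoly d (phi i)) ->
  hpoly d (fun v => \sum_(i <- r | P i) phi i v).
Proof.
move=> h; elim: r => [|i r IH].
  by apply: eq_hpoly (hpoly0 d) => v; rewrite big_nil.
case: (boolP (P i)) => Pi; last first.
  by apply: eq_hpoly IH => v; rewrite big_cons (negPf Pi).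
by apply: eq_hpoly (hpolyD (h i Pi) IH) => v; rewrite big_cons Pi.
Qed.

Lemma hpoly_prod (I : Type) (r : seq I) (d : I -> nat) (phi : I -> V -> K) :
  (forall i, hpoly (d i) (phi i)) ->
  hpoly (\sum_(i <- r) d i) (fun v => \prod_(i <- r) phi i v).
Proof.
move=> h; elim: r => [|i r IH].
  by rewrite big_nil; apply: eq_hpoly (hpoly_const 1) => v; rewrite big_nil.
rewrite big_cons; apply: eq_hpoly (hpolyM (h i) IH) => v.
by rewrite big_cons.
Qed.

Lemma hpoly_linear (u : V -> K^o) : linear u -> hpoly 1 u.
Proof.
move=> lu; pose U : {linear V -> K^o} :=
  HB.pack u (GRing.isLinear.Build K V K^o *:%R u lu).
exists (\sum_(i < \dim {:V}) U (vbasis {:V})`_i *: 'X_i) => [|v].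
  by apply: rpred_sum => i _; apply: rpredZ; rewrite dhomogX; exact/eqP/mdeg1.
rewrite /peval raddf_sum /= -[RHS]/(U v) [in RHS](coord_vbasis (memvf v)).
rewrite linear_sum; apply: eq_bigr => i _.
by rewrite mevalZ mevalXU linearZ mulrC.
Qed.

Lemma hpoly_scale d phi : hpoly d phi ->
  forall c v, phi (c *: v) = c ^+ d * phi v.
Proof.
move=> [P hP eP] c v; rewrite -!eP /peval -(homog_meval_scale hP).
by apply: meval_eq => i; rewrite linearZ.
Qed.

Lemma hpoly_at0 d phi : hpoly d.+1 phi -> phi 0 = 0.
Proof. by move/hpoly_scale/(_ 0 0); rewrite scale0r expr0n mul0r. Qed.

Lemma hpoly_line d phi v1 v2 : hpoly d phi ->
  exists q : {poly K}, forall s, q.[s] = phi (v1 + s *: (v2 - v1)).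
Proof.
move=> [P _ eP]; pose c i := coord (vbasis {:V}) i v1.
pose b i := coord (vbasis {:V}) i (v2 - v1).
exists (\sum_(m <- msupp P) P@_m *: \prod_i ((c i)%:P + b i *: 'X) ^+ m i).
move=> s; rewrite -eP /peval mevalE horner_sum; apply: eq_bigr => m _.
rewrite hornerZ horner_prod; congr (_ * _); apply: eq_bigr => i _.
by rewrite !hornerE linearD linearZ /= [s * _]mulrC.
Qed.

Lemma hpoly_det d h (A : V -> 'M[K]_h) :
  (forall i j, hpoly d (fun v => A v i j)) -> hpoly (h * d) (fun v => \det (A v)).
Proof.
move=> hA; apply: hpoly_sum => s _; apply: hpolyZ.
rewrite [(h * d)%N](_ : _ = (\sum_(i < h) d)%N); first exact: hpoly_prod.
by rewrite sum_nat_const card_ord.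
Qed.

Definition hmx d k l (A : V -> 'M[K]_(k, l)) : Prop :=
  forall i j, hpoly d (fun v => A v i j).

Lemma eq_hmx d k l (A B : V -> 'M[K]_(k, l)) : A =1 B -> hmx d A -> hmx d B.
Proof. by move=> E h i j; apply: eq_hpoly (h i j) => v; rewrite E. Qed.

Lemma hmx_deg d e k l (A : V -> 'M[K]_(k, l)) : d = e -> hmx d A -> hmx e A.
Proof. by move=> ->. Qed.

Lemma hmx_linear k l (f : {linear V -> 'M[K]_(k, l)}) : hmx 1 f.
Proof. by move=> i j; apply: hpoly_linear => c u v; rewrite linearP !mxE. Qed.

Lemma hmxM d e k l m (A : V -> 'M[K]_(k, l)) (B : V -> 'M[K]_(l, m)) :
  hmx d A -> hmx e B -> hmx (d + e) (fun v => A v *m B v).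
Proof.
move=> hA hB i j.
apply: (@eq_hpoly _ (fun v => \sum_l0 A v i l0 * B v l0 j)).
  by move=> v; rewrite mxE.
by apply: hpoly_sum => x _; apply: hpolyM.
Qed.

Lemma hmx_const k l (A : 'M[K]_(k, l)) : hmx 0 (fun _ => A).
Proof. by move=> i j; apply: hpoly_const. Qed.

Lemma hmxMl d k l m (A : 'M[K]_(k, l)) (B : V -> 'M[K]_(l, m)) :
  hmx d B -> hmx d (fun v => A *m B v).
Proof. by move/(hmxM (hmx_const A)). Qed.

Lemma hmxMr d k l m (A : V -> 'M[K]_(k, l)) (B : 'M[K]_(l, m)) :
  hmx d A -> hmx d (fun v => A v *m B).
Proof. by move/hmxM/(_ (hmx_const B)); rewrite addn0. Qed.

Lemma hmx_adj d h (A : V -> 'M[K]_h.+1) :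
  hmx d A -> hmx (h * d) (fun v => \adj (A v)).
Proof.
move=> hA i j; apply: (@eq_hpoly _ (fun v => cofactor (A v) j i)).
  by move=> v; rewrite mxE.
apply: hpolyZ; apply: hpoly_det => a b.
by apply: eq_hpoly (hA (lift j a) (lift i b)) => v; rewrite !mxE.
Qed.

Lemma hmxZ d e k l (phi : V -> K) (A : V -> 'M[K]_(k, l)) :
  hpoly d phi -> hmx e A -> hmx (d + e) (fun v => phi v *: A v).
Proof.
move=> hp hA i j; apply: eq_hpoly (hpolyM hp (hA i j)) => v.
by rewrite mxE.
Qed.

Lemma hmx_sum (I : Type) (r : seq I) d k l (A : I -> V -> 'M[K]_(k, l)) :
  (forall i, hmx d (A i)) -> hmx d (fun v => \sum_(i <- r) A i v).
Proof.
move=> hA i j; apply: (@eq_hpoly _ (fun v => \sum_(x <- r) A x v i j)).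
  by move=> v; rewrite summxE.
by apply: hpoly_sum => x _; exact: hA.
Qed.

Lemma hmxX d h k (A : V -> 'M[K]_h.+1) :
  hmx d A -> hmx (k * d) (fun v => A v ^+ k).
Proof.
move=> hA; elim: k => [|k IH]; first by move=> i j; apply: hpoly_const.
by move=> i j; apply: eq_hpoly (hmxM hA IH i j) => v; rewrite exprS.
Qed.

Lemma hmxD d k l (A B : V -> 'M[K]_(k, l)) :
  hmx d A -> hmx d B -> hmx d (fun v => A v + B v).
Proof.
by move=> hA hB i j; apply: eq_hpoly (hpolyD (hA i j) (hB i j)) => v; rewrite mxE.
Qed.

Lemma hmxN d k l (A : V -> 'M[K]_(k, l)) :
  hmx d A -> hmx d (fun v => - A v).
Proof.
by move=> hA i j; apply: eq_hpoly (hpolyN (hA i j)) => v; rewrite mxE.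
Qed.

Lemma hmx_prod (I : Type) (r : seq I) (d : I -> nat) h
    (A : I -> V -> 'M[K]_h.+1) :
  (forall i, hmx (d i) (A i)) ->
  hmx (\sum_(i <- r) d i) (fun v => \prod_(i <- r) A i v).
Proof.
move=> hA; elim: r => [|i r IH].
  rewrite big_nil => a b.
  by apply: eq_hpoly (hpoly_const ((1 : 'M_h.+1) a b)) => v; rewrite big_nil.
rewrite big_cons => a b; apply: eq_hpoly (hmxM (hA i) IH a b) => v.
by rewrite big_cons.
Qed.

End HPoly.

(** * Maps between vector spaces with homogeneous coordinates *)

Section HMap.
Variables (K : closedFieldType).

Definition hmap (V W : vectType K) (d : nat) (f : V -> W) : Prop :=
  forall i, hpoly d (fun v => coord (vbasis {:W}) i (f v)).

Lemma hmap_linear (V W : vectType K) (f : {linear V -> W}) : hmap 1 f.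
Proof.
by move=> i; apply: hpoly_linear => c u v; rewrite !linearP.
Qed.

Lemma hmap_span (V W : vectType K) (I : Type) (r : seq I) d
    (c : I -> V -> K) (w : I -> W) :
  (forall k, hpoly d (c k)) -> hmap d (fun v => \sum_(k <- r) c k v *: w k).
Proof.
move=> hc i.
apply: (@eq_hpoly _ _ _
  (fun v => \sum_(k <- r) coord (vbasis {:W}) i (w k) * c k v)).
  by move=> v; rewrite linear_sum; apply: eq_bigr => k _; rewrite linearZ /= mulrC.
by apply: hpoly_sum => k _; exact: hpolyZ.
Qed.

Lemma eq_hmap (V W : vectType K) d (f g : V -> W) :
  f =1 g -> hmap d f -> hmap d g.
Proof. by move=> E h i; apply: eq_hpoly (h i) => v; rewrite E. Qed.

Lemma hmap_ffun (V : vectType K) (J : finType) d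
    (f : V -> {ffun J -> K^o}) :
  (forall j, hpoly d (fun v => f v j)) -> hmap d f.
Proof.
move=> hf.
apply: (@eq_hmap _ _ _ (fun v => \sum_j f v j *: [ffun j' => (j' == j)%:R : K^o])).
  move=> v; apply/ffunP => j; rewrite sum_ffunE (bigD1 j) //= !ffunE eqxx.
  rewrite big1 ?addr0 => [|i ij]; first by rewrite /GRing.scale /= mulr1.
  by rewrite !ffunE eq_sym (negPf ij) scaler0.
exact: hmap_span.
Qed.

Lemma hpoly_comp (V W : vectType K) d e (phi : W -> K) (f : V -> W) :
  hpoly d phi -> hmap e f -> hpoly (d * e) (phi \o f).
Proof.
move=> [P hP eP] hf.
(* Repeating [m \in msupp P] as a filter makes [mdeg m = d] available in each term. *)
apply: (@eq_hpoly _ _ _ (fun v => \sum_(m <- msupp P | m \in msupp P)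
    P@_m * \prod_i coord (vbasis {:W}) i (f v) ^+ m i)).
  by move=> v; rewrite /= -eP /peval mevalE [in RHS]big_seq.
apply: hpoly_sum => m mP; apply: hpolyZ.
have <- : mdeg m = d by exact: (dhomog_mf hP).
rewrite mdegE big_distrl /=; apply: hpoly_prod => i; exact: hpolyX.
Qed.

Lemma hmap_ratmap (V W : vectType K) d (f : V -> W) : hmap d f ->
  exists r : ratmap V W, ratmap_eval r =1 f.
Proof.
move=> hf; have hf' i : exists P : polyfun V, P \is d.-homog /\
    forall v, peval P v = coord (vbasis {:W}) i (f v).
  by have [P ? ?] := hf i; exists P.
have [P hP] := boolp.choice hf'.
exists (@Ratmap _ _ _ d P (fun i => (hP i).1)) => v.
rewrite /ratmap_eval [RHS](coord_vbasis (memvf (f v))).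
by apply: eq_bigr => i _; rewrite (hP i).2.
Qed.

End HMap.

(** Nonempty basic open sets meet: on the line through [v1] and [v2] both functions are nonzero
    univariate polynomials, and their product has a nonroot. *)
Lemma line_avoid (K : closedFieldType) (V : vectType K) d e
    (phi psi : V -> K) v1 v2 :
  hpoly d phi -> hpoly e psi -> phi v1 != 0 -> psi v2 != 0 ->
  exists2 v, phi v != 0 & psi v != 0.
Proof.
move=> hp hq p1 q2.
have [p ep] := hpoly_line v1 v2 hp; have [q eq] := hpoly_line v1 v2 hq.
have p0 : p != 0.
  apply: contraNneq p1 => p0.
  by have := ep 0; rewrite p0 horner0 scale0r addr0 => <-.
have q0 : q != 0.
  apply: contraNneq q2 => q0.
  by have := eq 1; rewrite q0 horner0 scale1r addrC subrK => <-.
have [s ps] : exists s, (p * q).[s] != 0.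
  have [s] := closed_nonrootP (p * q) (mulf_neq0 p0 q0).
  by rewrite /root; exists s.
by move: ps; rewrite hornerM ep eq mulf_eq0 negb_or => /andP[]; exists (v1 + s *: (v2 - v1)).
Qed.

(** * Closed sets and parametrizations *)

Section Proj.
Variables (K : closedFieldType).
Implicit Types (V W : vectType K).

Lemma mkproj_subproof V (v : V) : v != 0 -> \dim <[v]>%VS == 1%N.
Proof. by rewrite dim_vline => ->. Qed.

Definition mkproj V (v : V) (v0 : v != 0) : proj V :=
  exist _ <[v]>%VS (mkproj_subproof v0).

Lemma vline_scale V (c : K) (v : V) : c != 0 -> <[c *: v]>%VS = <[v]>%VS.
Proof.
move=> c0; apply/eqP; rewrite eqEsubv -!memvE memvZ ?memv_line //=.
by apply/vlineP; exists c^-1; rewrite scalerA mulVf // scale1r.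
Qed.

Definition zeros V (T : Type) (phi : T -> V -> K) : set (proj V) :=
  [set x : proj V | forall b v, v \in \val x -> phi b v = 0].

Lemma proj_closed_zeros V (T : Type) (d : T -> nat) (phi : T -> V -> K) :
  (forall b, hpoly (d b) (phi b)) -> proj_closed (zeros phi).
Proof.
move=> hphi; exists [set P : polyfun V |
  exists b, P \is (d b).-homog /\ forall v, peval P v = phi b v].
split=> [P [b [hP _]]|]; first by exists (d b).
apply/seteqP; split=> x /= hx.
  by move=> P [b [_ eP]] v vx; rewrite eP; exact: hx.
by move=> b v vx; have [P hP eP] := hphi b; rewrite -eP; apply: hx => //; exists b.
Qed.

Lemma notin_zeros V (T : Type) (phi : T -> V -> K) x :
  ~ zeros phi x -> exists b, exists2 v, v \in \val x & phi b v != 0.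
Proof.
move=> nx; apply: contrapT => H; apply: nx => b v vx; apply/eqP.
by apply: contrapT => /negP pv; apply: H; exists b, v.
Qed.

Lemma in_zeros V (T : Type) (phi : T -> V -> K) (x : proj V) v b :
  v \in \val x -> phi b v != 0 -> ~ zeros phi x.
Proof. by move=> vx pv /(_ b v vx) /eqP; rewrite (negPf pv). Qed.

Lemma hpoly_span_neq0 V d (phi : V -> K) (v w : V) : hpoly d phi ->
  v \in <[w]>%VS -> phi v != 0 -> w != 0 -> phi w != 0.
Proof.
move=> hp /vlineP[c ->]; rewrite (hpoly_scale hp) mulf_eq0 negb_or.
by case/andP.
Qed.

Lemma proj_closedP V (A : set (proj V)) : proj_closed A ->
  exists (T : Type) (d : T -> nat) (phi : T -> V -> K),
    (forall b, hpoly (d b) (phi b)) /\ A = zeros phi.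
Proof.
move=> [I [hI ->]].
have hd (P : {P : polyfun V | I P}) : exists d, sval P \is d.-homog.
  by case: P => P IP; exact: hI.
have [d hd'] := boolp.choice hd.
exists {P : polyfun V | I P}, d, (fun P => peval (sval P)).
split=> [b|]; first by exists (sval b).
apply/seteqP; split=> x /= hx.
  by move=> [P IP] v vx /=; exact: hx.
by move=> P IP; exact: (hx (exist _ P IP)).
Qed.

Lemma sub_closure V (A : set (proj V)) : A `<=` proj_closure A.
Proof. by move=> x Ax B _; apply. Qed.

Lemma closure_set0 V : @proj_closure K V set0 = set0.
Proof.
apply/seteqP; split=> // x /(_ (zeros (fun (_ : unit) (_ : V) => 1))).
have hc : proj_closed (zeros (fun (_ : unit) (_ : V) => 1 : K)).
  by apply: (@proj_closed_zeros _ _ (fun _ => 0%N)) => _; exact: hpoly_const.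
move=> /(_ hc (sub0set _)) /(_ tt 0 (mem0v _)) /eqP.
by rewrite oner_eq0.
Qed.

(** * Sets parametrized by an open subset of a projective space *)

Section Parametrization.
Variables (V W : vectType K) (T : Type) (d : T -> nat) (psi : T -> V -> K).
Variables (e : nat) (f : V -> W) (D : set (proj W)).
Hypothesis hpsi : forall b, hpoly (d b) (psi b).
Hypothesis psi0 : forall b, psi b 0 = 0.
Hypothesis hf : hmap e f.
Hypothesis fD : forall b v, psi b v != 0 ->
  exists y, [/\ D y, f v != 0 & \val y = <[f v]>%VS].
Hypothesis Df : forall y, D y ->
  exists b v, psi b v != 0 /\ \val y = <[f v]>%VS.
Hypothesis D0 : D !=set0.

Variable X : set (proj W).
Hypothesis DX : D `<=` X.
Hypothesis XD : X `<=` proj_closure D.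

(** [D] is the image under [f] of the open set where some [psi b] is nonzero, and it is dense in
    [X]. If [D] lay neither in [A] nor in [B], an equation of each, pulled back along [f], would be
    nonzero somewhere; [line_avoid] then gives a point of [D] outside both. *)
Lemma irreducible_param : irreducible X.
Proof using hpsi psi0 hf fD Df D0 DX XD.
split; first by case: D0 => y /DX; exists y.
move=> A B cA cB XAB.
have [DA|DA] := pselect (D `<=` A).
  by left=> x /XD; apply.
right=> x /XD; apply=> // y Dy; apply: contrapT => By.
apply: DA => z Dz; apply: contrapT => Az.
have [TA [dA [pA [hA eA]]]] := proj_closedP cA.
have [TB [dB [pB [hB eB]]]] := proj_closedP cB.
rewrite {}eA in Az XAB cA; rewrite {}eB in By XAB cB.
have [b [w wz pw]] := notin_zeros Az.
have [c [w' wy pw']] := notin_zeros By.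
have [b1 [v1 [q1 z1]]] := Df Dz.
have [b2 [v2 [q2 z2]]] := Df Dy.
have f1 : pA b (f v1) != 0.
  have [? [_ fv _]] := fD q1; rewrite z1 in wz.
  by apply: (hpoly_span_neq0 (hA b) wz pw fv).
have f2 : pB c (f v2) != 0.
  have [? [_ fv _]] := fD q2; rewrite z2 in wy.
  by apply: (hpoly_span_neq0 (hB c) wy pw' fv).
(* The factors [psi] keep the common nonzero of the two functions inside the domain of the
   parametrization. *)
have h1 := hpolyM (hpoly_comp (hA b) hf) (hpsi b1).
have h2 := hpolyM (hpoly_comp (hB c) hf) (hpsi b2).
have [v] := line_avoid h1 h2 (mulf_neq0 f1 q1) (mulf_neq0 f2 q2).
rewrite /= !mulf_eq0 !negb_or => /andP[pv qv] /andP[pv' _].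
have [u [Du fv uv]] := fD qv.
have fu : f v \in \val u by rewrite uv memv_line.
by case: (XAB u (DX Du)); [exact: in_zeros fu pv | exact: in_zeros fu pv'].
Qed.

Lemma dominates_param : dominates [set: proj V] X.
Proof using hpsi psi0 hf fD Df D0 DX XD.
have [r er] := hmap_ratmap hf.
exists r, (zeros psi); split.
- exact: proj_closed_zeros hpsi.
- case: D0 => y /Df [b [v [pv _]]].
  have v0 : v != 0 by apply: contraNneq pv => ->; rewrite psi0.
  by move/(_ (mkproj v0) I); apply: (@in_zeros _ _ _ _ v b) => //=; rewrite memv_line.
- move=> x _ /notin_zeros [b [v vx pv]].
  have [y [Dy fv yv]] := fD pv; exists y; first exact: DX.
  by exists v; rewrite er yv memv_line.
- move=> x /XD Dx B cB sB; apply: Dx => // y Dy; apply: sB.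
  have [b [v [pv yv]]] := Df Dy.
  have v0 : v != 0 by apply: contraNneq pv => ->; rewrite psi0.
  have [z [_ fv _]] := fD pv.
  exists (mkproj v0); split=> //.
    by apply: (@in_zeros _ _ _ _ v b) => //=; rewrite memv_line.
  by exists v; rewrite er yv !memv_line.
Qed.

End Parametrization.

Lemma irreducible_component_irreducible V (X Y : set (proj V)) :
  irreducible X -> irreducible_component X Y -> Y = X.
Proof. by move=> iX [_ YX /(_ X iX YX) /(_ (fun _ h => h)) ->]. Qed.

End Proj.

(** * Ideals of finite sets of points *)

Section LinearForms.
Variables (K : closedFieldType) (n : nat).

Lemma lform_homog (u : 'I_n.+1 -> K) :
  (\sum_i u i *: 'X_i : {mpoly K[n.+1]}) \is 1.-homog.
Proof. by apply: rpred_sum => i _; rewrite rpredZ // dhomogX; apply/eqP/mdeg1. Qed.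

Definition lform (u : 'I_n.+1 -> K) : forms K n 1 := DHomog (lform_homog u).

Definition evalf d (u : 'I_n.+1 -> K) (p : forms K n d) : K^o :=
  (p : dhomog n.+1 K d).@[u].

Lemma evalf_is_linear d u : linear (@evalf d u).
Proof. by move=> c p q; rewrite /evalf /= mevalD mevalZ. Qed.

HB.instance Definition _ d u :=
  GRing.isLinear.Build K (forms K n d) K^o _ (@evalf d u) (@evalf_is_linear d u).

Lemma lform_coef u i : (\val (lform u))@_U_(i) = u i.
Proof.
rewrite /= raddf_sum /= (bigD1 i) //= mcoeffZ mcoeffXU eqxx mulr1 big1 ?addr0 //.
by move=> j ji; rewrite mcoeffZ mcoeffXU (negPf ji) mulr0.
Qed.

Lemma lform_eval u x : evalf x (lform u) = \sum_i u i * x i.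
Proof.
rewrite /evalf /= raddf_sum /=; apply: eq_bigr => i _.
by rewrite mevalZ mevalXU.
Qed.

Lemma homog_eq d (p q : {mpoly K[n.+1]}) : p \is d.-homog -> q \is d.-homog ->
  (forall m, mdeg m = d -> p@_m = q@_m) -> p = q.
Proof.
move=> hp hq E; apply/mpolyP => m; have [/E//|md] := eqVneq (mdeg m) d.
by rewrite (dhomog_nemf_coeff hp md) (dhomog_nemf_coeff hq md).
Qed.

Lemma lformK (L : forms K n 1) : lform (fun i => (\val L)@_U_(i)) = L.
Proof.
apply: val_inj; apply: (@homog_eq 1) => [||m /eqP /mdeg1P [i /eqP ->]].
- exact: dhomog_is_dhomog.
- exact: dhomog_is_dhomog.
by rewrite lform_coef.
Qed.

Lemma lformZ c u : lform (fun i => c * u i) = c *: lform u.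
Proof.
apply: val_inj; rewrite /= scaler_sumr; apply: eq_bigr => i _.
by rewrite scalerA.
Qed.

Lemma eq_lform u v : u =1 v -> lform u = lform v.
Proof.
by move=> E; apply: val_inj; rewrite /=; apply: eq_bigr => i _; rewrite E.
Qed.

Lemma lform_eq0 u : lform u = 0 -> forall i, u i = 0.
Proof. by move=> u0 i; rewrite -lform_coef u0 /= mcoeff0. Qed.

Lemma eval_at_lform p u : eval_at_form p (lform u) = p.@[u].
Proof. by apply: meval_eq => i; rewrite lform_coef. Qed.

Lemma evalf_scale d c u (p : forms K n d) :
  evalf (fun i => c * u i) p = c ^+ d * evalf u p.
Proof. by apply: homog_meval_scale; exact: dhomog_is_dhomog. Qed.

Lemma evalf_pow d x (L : forms K n 1) :
  evalf x (form_pow L d) = (evalf x L) ^+ d.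
Proof. by rewrite /evalf /= rmorphXn. Qed.

Definition fmul d e (p : forms K n d) (q : forms K n e) : forms K n (d + e) :=
  DHomog (dhomogM (dhomog_is_dhomog p) (dhomog_is_dhomog q)).

Lemma evalf_mul d e u (p : forms K n d) (q : forms K n e) :
  evalf u (fmul p q) = evalf u p * evalf u q.
Proof. by rewrite /evalf /= mevalM. Qed.

Lemma fone_homog : (1 : {mpoly K[n.+1]}) \is 0.-homog.
Proof. exact: dhomog1. Qed.

Definition fone : forms K n 0 := DHomog fone_homog.

Lemma evalf_one u : evalf u fone = 1.
Proof. by rewrite /evalf /= meval1. Qed.

End LinearForms.

Section Points.
Variables (K : closedFieldType) (n h : nat).
Implicit Types (U : 'M[K]_(n.+1, h)).

Definition pt U (j : 'I_h) : 'I_n.+1 -> K := fun i => U i j.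

Definition evl U t (p : forms K n t) : 'rV[K]_h := \row_j evalf (pt U j) p.

Lemma evl_is_linear U t : linear (@evl U t).
Proof. by move=> c p q; apply/rowP => j; rewrite !mxE linearP. Qed.

HB.instance Definition _ U t :=
  GRing.isLinear.Build K (forms K n t) 'rV[K]_h _ (@evl U t) (@evl_is_linear U t).

Definition ev U t : 'Hom(forms K n t, 'rV[K]_h) := linfun (@evl U t).

Lemma evE U t p : ev U t p = \row_j evalf (pt U j) p.
Proof. by rewrite lfunE. Qed.

Definition points U : set (dual_proj K n) :=
  [set x | exists j, \val x = <[lform (pt U j)]>%VS].

Definition distinct_points U : Prop :=
  (forall j, exists a, U a j != 0) /\
  (forall i j, i != j -> exists a b, U a i * U b j != U b i * U a j).

(** The scalar [c] sweeps the whole line of each point, since [p] need not be homogeneous. *)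
Lemma vanishing_points U p : (forall j, exists a, U a j != 0) ->
  vanishing_ideal (points U) p <->
  forall j c, p.@[fun i => c * U i j] = 0.
Proof.
move=> hU; split=> [hp j c|hp x [j xj] L].
  have l0 : lform (pt U j) != 0.
    by have [a] := hU j; apply: contraNneq => /lform_eq0/(_ a)/eqP.
  rewrite -eval_at_lform lformZ; apply: (hp (mkproj l0)) => /=; first by exists j.
  by rewrite memvZ // memv_line.
rewrite xj => /vlineP[c ->]; rewrite -lformZ eval_at_lform; exact: hp.
Qed.

Lemma homog_vanishing_points U d (p : forms K n d) :
  (forall j, exists a, U a j != 0) ->
  vanishing_ideal (points U) (p : dhomog n.+1 K d) <-> ev U d p = 0.
Proof.
move=> hU; rewrite vanishing_points //; split=> [hp|/rowP hp j c].
  apply/rowP => j; rewrite evE !mxE; have := hp j 1.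
  by rewrite (homog_meval_scale (dhomog_is_dhomog p)) expr1n mul1r.
rewrite (homog_meval_scale (dhomog_is_dhomog p)).
have := hp j; rewrite evE !mxE => e.
by rewrite (e : (p : dhomog n.+1 K d).@[fun i => U i j] = 0) mulr0.
Qed.

(** The form is a product of linear forms, each vanishing at one of the other points but not at the
    [i]-th, padded to degree [t] by a power of a coordinate that is nonzero there. *)
Lemma separating_form U t i : distinct_points U -> (h <= t)%N ->
  exists p : forms K n t, evalf (pt U i) p != 0 /\
    forall j, j != i -> evalf (pt U j) p = 0.
Proof.
move=> [nz np] ht.
have [a Ua] := nz i.
pose X := lform (fun b => (b == a)%:R : K).
have eX j : evalf (pt U j) X = U a j.
  rewrite lform_eval (bigD1 a) //= eqxx mul1r big1 ?addr0 // => b /negPf ->.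
  by rewrite mul0r.
have step (s : seq 'I_h) : i \notin s -> exists p : forms K n (size s),
    evalf (pt U i) p != 0 /\ forall j, j \in s -> evalf (pt U j) p = 0.
  elim: s => [|k s IH] /=; first by exists (fone K n); rewrite evalf_one oner_eq0.
  rewrite inE negb_or => /andP[ik /IH [p [p1 p2]]].
  have [b [c bc]] := np i k ik.
  (* The 2 by 2 minor of rows [b] and [c] against column [k]: it vanishes at the [k]-th point and,
     by the choice of [b] and [c], not at the [i]-th. *)
  pose m := lform (fun l => U c k * (l == b)%:R - U b k * (l == c)%:R).
  have em j : evalf (pt U j) m = U c k * U b j - U b k * U c j.
    rewrite lform_eval; under eq_bigr do rewrite mulrBl.
    rewrite sumrB; congr (_ - _).
      rewrite (bigD1 b) //= eqxx mulr1 big1 ?addr0 // => l /negPf ->.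
      by rewrite mulr0 mul0r.
    rewrite (bigD1 c) //= eqxx mulr1 big1 ?addr0 // => l /negPf ->.
    by rewrite mulr0 mul0r.
  exists (fmul m p : forms K n (size s).+1).
  have e j : @evalf K n (size s).+1 (pt U j) (fmul m p) =
      (U c k * U b j - U b k * U c j) * evalf (pt U j) p.
    by rewrite -em; exact: evalf_mul.
  split=> [|j]; rewrite e.
    by rewrite mulf_neq0 // subr_eq0 mulrC [eqbRHS]mulrC.
  rewrite inE => /orP[/eqP->|/p2->]; last by rewrite mulr0.
  by rewrite mulrC [U b k * _]mulrC subrr mulr0.
pose s := [seq j <- enum 'I_h | j != i].
have [|p [p1 p2]] := step s; first by rewrite mem_filter eqxx.
have sz : (size s <= t)%N.
  by apply: leq_trans ht; rewrite -[h in (_ <= h)%N]size_enum_ord size_filter count_size.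
pose q := fmul p (form_pow X (t - size s)).
rewrite -(subnKC sz).
exists q; split=> [|j ji].
  by rewrite evalf_mul evalf_pow eX mulf_neq0 // expf_neq0.
by rewrite evalf_mul p2 ?mul0r // mem_filter ji mem_enum.
Qed.

Lemma ev_presents U t : distinct_points U -> (h <= t)%N ->
  presents_piece (vanishing_ideal (points U)) (ev U t).
Proof.
move=> dU ht; split; last first.
  by move=> p; rewrite homog_vanishing_points ?memv_ker; [split=> /eqP|case: dU].
apply/eqP; rewrite eqEsubv subvf /=; apply/subvP => r _.
have hs i : exists p : forms K n t, ev U t p = delta_mx 0 i.
  have [p [p1 p2]] := separating_form i dU ht.
  exists ((evalf (pt U i) p)^-1 *: p); apply/rowP => j.
  rewrite linearZ /= mxE evE !mxE /=; have [->|ji] := eqVneq j i.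
    by rewrite mulVf.
  by rewrite (p2 j ji) mulr0.
have [s es] := boolp.choice hs.
rewrite (row_sum_delta r); apply: memv_suml => i _; rewrite memvZ // -es.
exact: memv_img (memvf _).
Qed.

Lemma vanishing_saturated U : (forall j, exists a, U a j != 0) ->
  saturated_homogeneous_ideal (vanishing_ideal (points U)).
Proof.
move=> hU; split.
- by rewrite vanishing_points // => j c; rewrite meval0.
- move=> p q; rewrite !vanishing_points // => hp hq j c.
  by rewrite mevalD hp hq addr0.
- by move=> p q; rewrite !vanishing_points // => hq j c; rewrite mevalM hq mulr0.
- move=> p d; rewrite !vanishing_points // => hp j c.
  rewrite (homog_meval_scale (pihomogP _ _ _)).
  suff -> : (pihomog mdeg d p).@[fun i => U i j] = 0 by rewrite mulr0.
  (* Along the line of the point, [p] is a univariate polynomial whose coefficients are the values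
     of its homogeneous components; it vanishes identically, hence so does each coefficient. *)
  pose k := maxn d.+1 (mmeasure mdeg p).
  pose q := \poly_(e < k) (pihomog mdeg e p).@[fun i => U i j].
  have q0 : q = 0.
    apply/eqP; apply: contraT => /closed_nonrootP [x].
    rewrite /root horner_poly => /eqP []; apply: etrans (hp j x).
    rewrite [in RHS](@pihomog_partitionE _ _ mdeg k p) ?leq_maxr //.
    rewrite raddf_sum /=. apply: eq_bigr => e _.
    by rewrite (homog_meval_scale (pihomogP _ _ _)) mulrC.
  have := congr1 (fun q : {poly K} => q`_d) q0.
  by rewrite coef_poly coef0 leq_maxl.
- move=> p [k hk]; rewrite vanishing_points // => j c.
  (* At the origin a positive power of a coordinate vanishes, so the hypothesis cannot be divided
     there. Instead, [p] along the line times [x ^+ k] is the zero polynomial, so [p] along the line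
     is zero, and it is evaluated at 0. *)
  have [->|c0] := eqVneq c 0.
    have [a Ua] := hU j.
    have hq : forall x, (p.@[fun i => x * U i j]) * x ^+ k = 0.
      move=> x; have := hk a; rewrite vanishing_points // => /(_ j x).
      rewrite mevalM rmorphXn /= mevalXU => /eqP; rewrite mulf_eq0 expf_eq0 mulf_eq0.
      rewrite (negPf Ua) orbF => /orP[/andP[k0 /eqP->]|/eqP->]; last by rewrite mul0r.
      by rewrite expr0n eqn0Ngt k0 mulr0.
    pose q : {poly K} := \sum_(m <- msupp p) (p@_m) *: \prod_i (U i j *: 'X) ^+ m i.
    have eq x : q.[x] = p.@[fun i => x * U i j].
      rewrite mevalE horner_sum; apply: eq_bigr => m _.
      rewrite hornerZ horner_prod; congr (_ * _); apply: eq_bigr => i _.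
      by rewrite !hornerE mulrC.
    have q0 : q * 'X ^+ k = 0.
      apply/eqP; apply: contraT => /closed_nonrootP [x].
      by rewrite /root !hornerE eq hq eqxx.
    rewrite -eq; move/eqP: q0.
    by rewrite mulf_eq0 expf_eq0 polyX_eq0 andbF orbF => /eqP ->; rewrite horner0.
  have [a Ua] := hU j.
  have := hk a; rewrite vanishing_points // => /(_ j c).
  rewrite mevalM rmorphXn /= mevalXU => /eqP; rewrite mulf_eq0 expf_eq0 mulf_eq0.
  by rewrite (negPf Ua) (negPf c0) andbF => /eqP.
Qed.

Lemma vanishing_length U : distinct_points U ->
  length_ideal h (vanishing_ideal (points U)).
Proof.
move=> dU; split; first by apply: vanishing_saturated; case: dU.
by exists h => t ht; exists (ev U t); exact: ev_presents.
Qed.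

End Points.

(** * Orthogonal matrices *)

Section Orthogonal.
Variable K : closedFieldType.
Hypothesis two0 : 2%:R != 0 :> K.

Definition signs h (s : {ffun 'I_h -> bool}) : 'rV[K]_h := \row_i (-1) ^+ s i.

(* Weighted by the product of the signs, the determinants below sum to [2 ^ h]. *)
Lemma exists_signs h (Q : 'M[K]_h) :
  exists s, \det (Q + diag_mx (signs s)) != 0.
Proof.
apply/existsP; apply: contraT; rewrite negb_exists => /forallP H.
have : \sum_(s : {ffun 'I_h -> bool})
    (\prod_i (-1) ^+ s i) * \det (Q + diag_mx (signs s)) = 0 :> K.
  by apply: big1 => s _; have := H s; rewrite negbK => /eqP ->; rewrite mulr0.
rewrite /determinant; under eq_bigr do rewrite mulr_sumr.
(* Only the identity permutation survives: its factors are [(Q i i + 1) - (Q i i - 1) = 2], while a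
   permutation [p] moving [i] has the factor [Q i (p i) - Q i (p i) = 0]. *)
rewrite exchange_big /= (bigD1 (1 : {perm 'I_h})%g) //= [X in _ + X]big1 => [|p p1].
  rewrite addr0.
  under eq_bigr do rewrite mulrCA -big_split /=.
  rewrite -mulr_sumr.
  rewrite (eq_bigr (fun s : {ffun 'I_h -> bool} =>
    \prod_i ((-1) ^+ s i * (Q i i + (-1) ^+ s i)))); last first.
    by move=> s _; apply: eq_bigr => i _; rewrite perm1 !mxE eqxx.
  rewrite -(bigA_distr_bigA (fun i (b : bool) => (-1) ^+ b * (Q i i + (-1) ^+ b))).
  rewrite (eq_bigr (fun=> 2%:R)) => [|i _].
    move/eqP; rewrite mulf_eq0 signr_eq0 /= prodr_const expf_eq0 (negPf two0).
    by rewrite andbF.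
  by rewrite big_bool /=; ring.
under eq_bigr do rewrite mulrCA -big_split /=.
rewrite -mulr_sumr.
rewrite (eq_bigr (fun s : {ffun 'I_h -> bool} =>
    \prod_i ((-1) ^+ s i * (Q i (p i) + (-1) ^+ s i *+ (i == p i))))); last first.
  by move=> s _; apply: eq_bigr => i _; rewrite !mxE.
rewrite -(bigA_distr_bigA (fun i (b : bool) =>
  (-1) ^+ b * (Q i (p i) + (-1) ^+ b *+ (i == p i)))).
have [i pi] : exists i, p i != i.
  apply/existsP; apply: contraNT p1; rewrite negb_exists => /forallP E.
  by apply/eqP/permP => i; rewrite perm1; apply/eqP; rewrite -[_ == _]negbK.
rewrite (bigD1 i) //= big_bool /= eq_sym (negPf pi) !mulr0n !addr0 expr0 expr1.
by rewrite mulN1r mul1r addNr mul0r mulr0.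
Qed.

(* The Cayley transform [(t - S) (t + S)^-1], with denominators cleared. *)
Definition cayley h (t : K) (S : 'M[K]_h) : 'M[K]_h :=
  (t%:M - S) *m \adj (t%:M + S).

Lemma adjE h (P : 'M[K]_h.+1) : \det P != 0 -> \adj P = \det P *: P^-1.
Proof.
move=> d0; have uP : P \in unitmx by rewrite unitmxE unitfE.
by rewrite /GRing.inv /= /invmx uP scalerA mulfV // scale1r.
Qed.

(** For skew [S], [t - S] is the transpose of [t + S]; the two commute and have the same
    determinant, so only the determinants coming from the two adjugates remain. *)
Lemma cayley_orthogonal h t (S : 'M[K]_h.+1) : S^T = - S ->
  \det (t%:M + S) != 0 ->
  cayley t S *m (cayley t S)^T = (\det (t%:M + S) ^+ 2)%:M.
Proof.
move=> sS d0; rewrite /cayley.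
set P := t%:M + S in d0 *; set M := t%:M - S.
have PT : P^T = M by rewrite linearD /= tr_scalar_mx sS.
have MT : M^T = P by rewrite -PT trmxK.
have dM : \det M = \det P by rewrite -PT det_tr.
have cPM : P * M = M * P.
  have c : GRing.comm t%:M S by exact/esym/scalar_mxC.
  rewrite /P /M mulrDl !mulrDr !mulrDl !mulrN !mulNr c.
  by [].
have uP : P \is a GRing.unit by rewrite -[_ \is a _]/(P \in unitmx) unitmxE unitfE.
have uM : M \is a GRing.unit.
  by rewrite -[_ \is a _]/(M \in unitmx) unitmxE unitfE dM.
rewrite trmx_mul trmx_adj MT PT !adjE ?dM //.
rewrite !mulmxE -scalerAr -!scalerAl -scalerAr scalerA -expr2.
rewrite mulrA -[M * _ * _]mulrA -invrM // -cPM invrM // mulrA mulrV // mul1r mulVr //.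
by rewrite -scalemx1.
Qed.

(** The Cayley transform is an involution: [S = (1 - Q) / (1 + Q)], and [(1 + S) * (1 + Q) = 2]
    shows that [1 + S] is invertible. *)
Lemma cayley_surj h (Q : 'M[K]_h.+1) : Q *m Q^T = 1%:M -> \det (1 + Q) != 0 ->
  exists S : 'M[K]_h.+1, [/\ S^T = - S, \det (1%:M + S) != 0 &
    cayley 1 S = \det (1%:M + S) *: Q].
Proof.
move=> QQ d0; have uQ : 1 + Q \is a GRing.unit.
  by rewrite -[_ \is a _]/(_ \in unitmx) unitmxE unitfE.
have QTQ : Q^T * Q = 1 by exact: mulmx1C.
pose S := (1 - Q) / (1 + Q).
have SQ : S * (1 + Q) = 1 - Q by rewrite divrK.
have S1 : (1 + S) * (1 + Q) = 2%:R.
  by rewrite mulrDl SQ mul1r addrACA subrr addr0.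
have S2 : (1 - S) * (1 + Q) = 2%:R * Q.
  by rewrite mulrBl SQ mul1r opprB [1 + Q]addrC addrACA subrr addr0 mulr_natl.
have dS : \det (1 + S) != 0.
  have := congr1 determinant S1; rewrite det_mulmx => E.
  apply: contraNneq two0 => z; move/eqP: E; rewrite z mul0r eq_sym.
  have -> : 2%:R = (2%:R)%:M :> 'M[K]_h.+1 by rewrite -scalemx1 scaler_nat.
  by rewrite det_scalar expf_eq0 => /andP[].
exists S; split=> //.
  apply/eqP; rewrite -subr_eq0 opprK; apply/eqP.
  (* Skewness is tested after multiplying by [(1 + Q)^T] on the left and [1 + Q] on the right, where
     [S] becomes [Q^T - Q]. *)
  have uQT : (1 + Q)^T \is a GRing.unit.
    by rewrite -[_ \is a _]/(_ \in unitmx) unitmx_tr.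
  apply: (mulrI uQT); apply: (mulIr uQ).
  have E1 : (1 + Q)^T * S * (1 + Q) = Q^T - Q.
    rewrite -mulrA SQ linearD /= trmx1 -[1%:M]/(1 : 'M_h.+1).
    by rewrite mulrDl !mulrBr QTQ !mul1r mulr1 addrC addrA subrK.
  have E2 : (1 + Q)^T * S^T * (1 + Q) = Q - Q^T.
    apply: (can_inj (@trmxK _ _ _)); rewrite !trmx_mul !trmxK.
    by rewrite !mulmxE mulrA E1 linearB /= trmxK.
  rewrite mulr0 mul0r [_ * (S^T + S)]mulrDr mulrDl E1 E2 addrA subrK subrr //.
have -> : 1%:M = 1 :> 'M[K]_h.+1 by [].
rewrite /cayley adjE // mulmxE -scalerAr; congr (_ *: _).
have u2 : (1 + S) \is a GRing.unit.
  by rewrite -[_ \is a _]/(_ \in unitmx) unitmxE unitfE.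
apply: (mulIr u2); rewrite divrK //; apply: (mulIr uQ).
by rewrite S2 -mulrA S1 mulr_natl mulr_natr.
Qed.

Lemma closed_sqrt (c : K) : exists s, s ^+ 2 = c.
Proof.
have /closed_rootP [s] : size ('X^2 - c%:P) != 1.
  by rewrite size_XnsubC.
by rewrite /root !hornerE subr_eq0 => /eqP; exists s.
Qed.

(** As [A *m A^T] is invertible, the dot product is nondegenerate on the kernel of [A]; so some
    vector of the kernel is not isotropic, and a square root normalizes it. *)
Lemma ker_unit_vector m h (A : 'M[K]_(m, h)) : A *m A^T \in unitmx -> (m < h)%N ->
  exists c : 'rV[K]_h, A *m c^T = 0 /\ c *m c^T = 1%:M.
Proof.
move=> uG mh; set G := A *m A^T in uG.
have [r rA r0] : exists2 r : 'rV[K]_h, r *m A^T = 0 & r != 0.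
  have /rowV0Pn [r /sub_kermxP rA r0] : kermx A^T != 0; last by exists r.
  rewrite -mxrank_eq0 mxrank_ker subn_eq0 -ltnNge.
  exact: leq_ltn_trans (rank_leq_col _) mh.
have [s [sA rs]] : exists s : 'rV[K]_h, s *m A^T = 0 /\ (r *m s^T) 0 0 != 0.
  have [i ri] : exists i, r 0 i != 0.
    apply/existsP; apply: contraNT r0; rewrite negb_exists => /forallP H.
    by apply/eqP/rowP => i; rewrite mxE; apply/eqP; rewrite -[_ == _]negbK.
  pose d : 'rV[K]_h := delta_mx 0 i.
  (* The orthogonal projection of a basis vector to the kernel; its product with [r] is still
     [r 0 i]. *)
  exists (d - d *m A^T *m invmx G *m A); split.
    by rewrite mulmxBl -[_ *m A *m _]mulmxA -/G mulmxKV // subrr.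
  rewrite linearB /= mulmxBr [(_ *m A)^T]trmx_mul [r *m (A^T *m _)]mulmxA rA mul0mx subr0.
  rewrite mxE (bigD1 i) //= !mxE !eqxx mulr1 big1 ?addr0 // => j /negPf ji.
  by rewrite !mxE ji andbF mulr0.
have [v [vA vv]] : exists v : 'rV[K]_h, v *m A^T = 0 /\ (v *m v^T) 0 0 != 0.
  have [rr|] := eqVneq ((r *m r^T) 0 0) 0; last by exists r.
  have [ss|] := eqVneq ((s *m s^T) 0 0) 0; last by exists s.
  (* For isotropic [r] and [s], the square of [r + s] is twice their product. *)
  exists (r + s); split; first by rewrite mulmxDl rA sA addr0.
  have sr : (s *m r^T) 0 0 = (r *m s^T) 0 0.
    by rewrite -[s *m r^T]trmxK trmx_mul trmxK mxE.
  rewrite linearD /= mulmxDl !mulmxDr mxE [X in X + _]mxE [X in _ + X]mxE rr ss.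
  by rewrite sr add0r addr0 -mulr2n -mulr_natl mulf_neq0.
have [q eq] := closed_sqrt ((v *m v^T) 0 0).
have q0 : q != 0 by rewrite -sqrf_eq0 eq.
exists (q^-1 *: v); split.
  by apply: trmx_inj; rewrite trmx_mul trmxK -scalemxAl vA scaler0 trmx0.
rewrite linearZ /= -scalemxAl -scalemxAr scalerA [v *m _]mx11_scalar -eq.
by rewrite scale_scalar_mx -expr2 -exprMn mulVf // expr1n.
Qed.

(** Unit vectors of the kernel are found one at a time and appended to [A] as rows, which keeps the
    Gram matrix invertible. *)
Lemma gram_complement k m h (A : 'M[K]_(m, h)) : h = (m + k)%N ->
  A *m A^T \in unitmx ->
  exists C : 'M[K]_(k, h), A *m C^T = 0 /\ C *m C^T = 1%:M.
Proof.
elim: k m A => [|k IH] m A hE uG.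
  by exists 0; split; [rewrite trmx0 mulmx0 | rewrite [LHS]flatmx0 [RHS]flatmx0].
have [|c [Ac cc]] := ker_unit_vector uG; first by rewrite hE addnS ltnS leq_addr.
have cA : c *m A^T = 0 by apply: trmx_inj; rewrite trmx_mul trmxK Ac trmx0.
have [||C []] := IH (m + 1)%N (col_mx A c).
- by rewrite hE addn1 addnS.
- rewrite tr_col_mx mul_col_row Ac cA cc unitmxE det_lblock det1 mulr1.
  by rewrite -unitmxE.
rewrite mul_col_mx -(col_mx0 _ m 1) => /eq_col_mx [AC cC CC].
have Cc : C *m c^T = 0 by apply: trmx_inj; rewrite trmx_mul trmxK cC trmx0.
suff H : A *m (col_mx c C)^T = 0 /\ col_mx c C *m (col_mx c C)^T = 1%:M.
  by exists (col_mx c C).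
rewrite tr_col_mx; split; first by rewrite mul_mx_row Ac AC row_mx0.
by rewrite mul_col_row cc cC Cc CC -scalar_mx_block.
Qed.

Lemma gram_unit_leq m h (A : 'M[K]_(m, h)) : A *m A^T \in unitmx -> (m <= h)%N.
Proof.
move=> uG; rewrite -(mxrank_unit uG); apply: leq_trans (mxrankM_maxl _ _) _.
exact: rank_leq_col.
Qed.

(** Orthonormal complements extend [A] and [B] to square matrices [P] and [R] with the same
    invertible Gram matrix, and [Q = P^-1 R]. *)
Lemma witt m h (A B : 'M[K]_(m, h)) : A *m A^T \in unitmx ->
  A *m A^T = B *m B^T ->
  exists2 Q : 'M[K]_h, Q *m Q^T = 1%:M & B = A *m Q.
Proof.
move=> uA AB; have hE : h = (m + (h - m))%N by rewrite subnKC //; exact: gram_unit_leq uA.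
have uB : B *m B^T \in unitmx by rewrite -AB.
move: (h - m)%N hE => k hE; subst h.
have [C [AC CC]] := gram_complement erefl uA.
have [D [BD DD]] := gram_complement erefl uB.
have CA : C *m A^T = 0 by apply: trmx_inj; rewrite trmx_mul trmxK AC trmx0.
have DB : D *m B^T = 0 by apply: trmx_inj; rewrite trmx_mul trmxK BD trmx0.
pose P := col_mx A C; pose R := col_mx B D.
have PR : P *m P^T = R *m R^T.
  by rewrite !tr_col_mx !mul_col_row AC BD CA DB CC DD AB.
have uP : P \in unitmx.
  have : P *m P^T \in unitmx.
    rewrite tr_col_mx mul_col_row AC CA CC unitmxE det_lblock det1 mulr1.
    by rewrite -unitmxE.
  by rewrite unitmx_mul => /andP[].
exists (invmx P *m R).
  rewrite trmx_mul mulmxA -[_ *m R *m _]mulmxA -PR mulmxA mulVmx // mul1mx.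
  by rewrite -trmx_mul mulVmx // trmx1.
have : P *m (invmx P *m R) = R by rewrite mulKVmx.
by rewrite mul_col_mx => /eq_col_mx [].
Qed.

End Orthogonal.

(** * Plücker coordinates and sums of squares *)

Section Plucker.
Variables (K : closedFieldType) (V : vectType K) (h : nat).
Implicit Types (a : 'Hom(V, 'rV[K]_h)) (f : 'I_h -> V).

(** The linear functional which, by multilinear expansion, takes on the Plücker vector of [a] the
    value of the minor at arbitrary vectors [f i] instead of basis vectors. *)
Definition minor f (y : plucker_space V h) : K^o :=
  \sum_(J : {ffun 'I_h -> 'I_(\dim {:V})})
    (\prod_i coord (vbasis {:V}) (J i) (f i)) * y J.

Lemma minor_is_linear f : linear (minor f).
Proof.
move=> c y z; rewrite /minor scaler_sumr -big_split; apply: eq_bigr => J _ /=.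
by rewrite !ffunE mulrDr; congr (_ + _); rewrite /GRing.scale /= mulrCA.
Qed.

HB.instance Definition _ f :=
  GRing.isLinear.Build K (plucker_space V h) K^o _ (minor f) (minor_is_linear f).

Lemma minor_plucker f a :
  minor f (plucker a) = \det (\matrix_(i < h, j < h) a (f i) 0 j).
Proof.
rewrite /minor /determinant.
under [RHS]eq_bigr => s _.
  under eq_bigr => i _.
    rewrite mxE [in f i](coord_vbasis (memvf (f i))) linear_sum summxE.
    under eq_bigr do rewrite linearZ mxE.
    over.
  rewrite bigA_distr_bigA /= mulr_sumr.
  over.
rewrite exchange_big; apply: eq_bigr => J _.
rewrite ffunE /determinant mulr_sumr; apply: eq_bigr => s _.
rewrite big_split /= mulrCA; congr (_ * (_ * _)).
by apply: eq_bigr => i _; rewrite !mxE.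
Qed.

Lemma plucker_mulmx a a' (G : 'M[K]_h) : (forall p, a' p = a p *m G) ->
  plucker a' = \det G *: plucker a.
Proof.
move=> E; apply/ffunP => J; rewrite !ffunE /GRing.scale /= mulrC -det_mulmx.
by congr (\det _); apply/matrixP => i j; rewrite !mxE E mxE; apply: eq_bigr => k _; rewrite mxE.
Qed.

Lemma limg_section a : limg a = fullv ->
  exists s : 'I_h -> V, forall i, a (s i) = delta_mx 0 i.
Proof.
move=> aV; have hs i : exists v, a v = delta_mx 0 i.
  have : delta_mx 0 i \in limg a by rewrite aV memvf.
  by case/memv_imgP => v _ ->; exists v.
by have [s es] := boolp.choice hs; exists s.
Qed.

Lemma plucker_neq0 a : limg a = fullv -> plucker a != 0.
Proof.
case/limg_section => s es; apply/eqP => a0; have := minor_plucker s a.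
rewrite a0 linear0 (_ : \matrix_(i, j) _ = 1%:M); last first.
  by apply/matrixP => i j; rewrite !mxE es !mxE eqxx eq_sym.
by rewrite det1 => /eqP; rewrite eq_sym oner_eq0.
Qed.

(** Surjections with the same kernel factor through each other by mutually inverse matrices. Hence a
    point of the Hilbert scheme does not depend on the chosen presentation. *)
Lemma plucker_ker a a' : limg a = fullv -> limg a' = fullv ->
  (forall p, (p \in lker a) <-> (p \in lker a')) ->
  exists2 c, c != 0 & plucker a' = c *: plucker a.
Proof.
have fac (b b' : 'Hom(V, 'rV[K]_h)) : limg b = fullv ->
    (forall p, p \in lker b -> p \in lker b') ->
    exists G : 'M[K]_h, forall p, b' p = b p *m G.
  case/limg_section => s es kb; exists (\matrix_(i, j) b' (s i) 0 j) => p.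
  have : p - \sum_i b p 0 i *: s i \in lker b.
    rewrite memv_ker linearB linear_sum /= subr_eq0; apply/eqP.
    rewrite {1}[b p]row_sum_delta; apply: eq_bigr => i _.
    by rewrite linearZ /= es.
  move/kb; rewrite memv_ker linearB linear_sum /= subr_eq0 => /eqP ->.
  apply/rowP => j; rewrite summxE mxE; apply: eq_bigr => i _.
  by rewrite linearZ /= !mxE.
move=> aV a'V E.
have [G eG] := fac a a' aV (fun p => (E p).1).
have [G' eG'] := fac a' a a'V (fun p => (E p).2).
exists (\det G); last exact: plucker_mulmx.
have GG : G *m G' = 1%:M.
  have [s es] := limg_section aV; apply/row_matrixP => i.
  rewrite row_mul !rowE mulmx1 -(es i) -eG -eG' es.
  by [].
apply/eqP => dG; have := congr1 determinant GG.
by rewrite det_mulmx dG mul0r det1 => /eqP; rewrite eq_sym oner_eq0.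
Qed.

End Plucker.

Lemma hilb_point_plucker (K : closedFieldType) (n h : nat)
    (I : set {mpoly K[n.+1]}) (a : 'Hom(forms K n h, 'rV[K]_h))
    (z : proj (hilb_space K n h)) :
  presents_piece I a -> hilb_point I z <-> \val z = <[plucker a]>%VS.
Proof.
move=> pa; split=> [[a' [pa' ->]]|zE]; last by exists a.
have [aV ka] := pa; have [a'V ka'] := pa'.
have [c c0 ->] : exists2 c, c != 0 & plucker a' = c *: plucker a.
  by apply: plucker_ker => // p; rewrite ka -ka'.
exact: vline_scale.
Qed.

(** * Quadrics, Gram matrices and polyhedra as matrices *)

Section Quadrics.
Variables (K : closedFieldType) (n : nat).
Hypothesis K0 : [pchar K] =i pred0.

Let natr0 m : (m.+1%:R != 0 :> K).
Proof. by rewrite (pcharf0P K).1. Qed.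

Lemma quad_homog (G : 'M[K]_n.+1) :
  (\sum_i \sum_j G i j *: ('X_i * 'X_j) : {mpoly K[n.+1]}) \is 2.-homog.
Proof.
apply: rpred_sum => i _; apply: rpred_sum => j _; apply: rpredZ.
rewrite -mpolyXD dhomogX; apply/eqP.
by rewrite -[LHS]/(mdeg (U_(i) + U_(j))%MM) mdegD !mdeg1.
Qed.

Definition quad G : forms K n 2 := DHomog (quad_homog G).

Lemma quad_is_linear : linear quad.
Proof.
move=> c A B; apply: val_inj; rewrite /= scaler_sumr -big_split.
apply: eq_bigr => i _; rewrite scaler_sumr -big_split; apply: eq_bigr => j _ /=.
by rewrite !mxE scalerDl scalerA.
Qed.

HB.instance Definition _ := GRing.isLinear.Build K 'M[K]_n.+1 (forms K n 2) _
  quad quad_is_linear.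

Lemma quad_eval G u : evalf u (quad G) = \sum_i \sum_j G i j * (u i * u j).
Proof.
rewrite /evalf /= raddf_sum; apply: eq_bigr => i _.
rewrite raddf_sum; apply: eq_bigr => j _ /=.
by rewrite mevalZ mevalM !mevalXU.
Qed.

Lemma quad_sqr u : form_pow (lform u) 2 = quad (\matrix_(i, j) (u i * u j)).
Proof.
apply: val_inj; rewrite /= expr2 mulr_suml; apply: eq_bigr => i _.
rewrite mulr_sumr; apply: eq_bigr => j _.
by rewrite mxE -scalerAl -scalerAr scalerA.
Qed.

Lemma quad_surj (F : forms K n 2) : exists G, F = quad G.
Proof.
suff [G eG] : exists G, (F : dhomog n.+1 K 2) = val (quad G) :> {mpoly K[n.+1]}.
  by exists G; apply: val_inj.
have span (s : seq 'X_{1..n.+1}) (c : 'X_{1..n.+1} -> K) :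
    (forall m, m \in s -> mdeg m = 2) ->
    exists G, \sum_(m <- s) c m *: 'X_[m] = val (quad G).
  elim: s => [|m s IH] ms; first by exists 0; rewrite big_nil linear0.
  have [|G eG] := IH; first by move=> k ks; apply: ms; rewrite inE ks orbT.
  have md : mdeg m = 2 by apply: ms; rewrite mem_head.
  have [i mi] : exists i, (0 < m i)%N.
    apply: contrapT => H; suff: mdeg m = 0%N by rewrite md.
    rewrite mdegE big1 // => i _; apply/eqP; rewrite -leqn0 leqNgt.
    by apply/negP => ?; apply: H; exists i.
  have le : (U_(i) <= m)%MM.
    by apply/mnm_lepP => j; rewrite mnm1E; case: eqP => [<-|].
  have /mdeg1P [j /eqP mj] : mdeg (m - U_(i))%MM == 1%N.
    apply/eqP/(@addnI (mdeg U_(i)%MM)).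
    by rewrite -mdegD addmC submK // md mdeg1.
  have eX : 'X_[m] = 'X_i * 'X_j :> {mpoly K[n.+1]}.
    by rewrite -mpolyXD -mj addmC submK.
  exists (c m *: delta_mx i j + G); rewrite big_cons eG linearP; congr (_ *: _ + _).
  rewrite eX /= (bigD1 i) //= (bigD1 j) //= mxE !eqxx scale1r !big1 ?addr0 //.
    by move=> k ki; rewrite big1 // => l _; rewrite mxE (negPf ki) scale0r.
  by move=> k kj; rewrite mxE eqxx (negPf kj) scale0r.
have [|G eG] := span (msupp (F : dhomog n.+1 K 2))
    (fun m => (F : dhomog n.+1 K 2)@_m).
  by move=> m; exact: (dhomog_mf (dhomog_is_dhomog F)).
by exists G; rewrite -eG -mpolyE.
Qed.

Definition unitv (i : 'I_n.+1) : 'I_n.+1 -> K := fun k => (k == i)%:R.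

(** Polarization recovers the symmetric matrix of the quadric from its values. *)
Definition gram (F : forms K n 2) : 'M[K]_n.+1 := \matrix_(i, j)
  (2%:R^-1 * (evalf (fun k => unitv i k + unitv j k) F
              - evalf (unitv i) F - evalf (unitv j) F)).

Lemma gram_is_linear : linear gram.
Proof.
move=> c F G; apply/matrixP => i j; rewrite !mxE !linearP /=.
rewrite /GRing.scale /=.
ring.
Qed.

HB.instance Definition _ := GRing.isLinear.Build K (forms K n 2) 'M[K]_n.+1 _
  gram gram_is_linear.

Lemma sum_unitv (c : 'I_n.+1 -> K) i : \sum_k c k * unitv i k = c i.
Proof.
rewrite (bigD1 i) //= /unitv eqxx mulr1 big1 ?addr0 // => k /negPf ->.
by rewrite mulr0.
Qed.

Lemma gram_quad G : gram (quad G) = 2%:R^-1 *: (G + G^T).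
Proof.
have bil u v : \sum_i \sum_j G i j * (u i * v j) =
    \sum_i (\sum_j G i j * v j) * u i.
  by apply: eq_bigr => i _; rewrite mulr_suml; apply: eq_bigr => j _;
    rewrite [u i * _]mulrC mulrA.
have uu i j : \sum_k \sum_l G k l * (unitv i k * unitv j l) = G i j.
  by rewrite bil sum_unitv sum_unitv.
apply/matrixP => i j; rewrite !mxE; congr (_ * _); rewrite !quad_eval !uu.
transitivity (G i i + G i j + (G j i + G j j) - G i i - G j j).
  congr (_ - _ - _); rewrite -!uu -!big_split; apply: eq_bigr => k _ /=.
  by rewrite -!big_split; apply: eq_bigr => l _ /=; rewrite -!mulrDr -mulrDl.
ring.
Qed.

Lemma quadK G : G^T = G -> gram (quad G) = G.
Proof.
move=> sG; rewrite gram_quad sG -mulr2n -scaler_nat scalerA mulVf ?scale1r //.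
Qed.

Lemma gramK F : quad (gram F) = F.
Proof.
have [G ->] := quad_surj F; rewrite gram_quad linearZ linearD /=.
have -> : quad G^T = quad G.
  apply: val_inj; rewrite /= exchange_big; apply: eq_bigr => i _.
  by apply: eq_bigr => j _; rewrite mxE mulrC.
by rewrite -mulr2n -scaler_nat scalerA mulVf ?scale1r.
Qed.

Lemma gram_sqr u : gram (form_pow (lform u) 2) = \matrix_(i, j) (u i * u j).
Proof. by rewrite quad_sqr quadK //; apply/matrixP => i j; rewrite !mxE mulrC. Qed.

Definition sqr h (U : 'M[K]_(n.+1, h)) (i : 'I_h) : forms K n 2 :=
  form_pow (lform (pt U i)) 2.

Lemma gram_sum h (U : 'M[K]_(n.+1, h)) (c : 'I_h -> K) :
  gram (\sum_i c i *: sqr U i) = U *m diag_mx (\row_i c i) *m U^T.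
Proof.
rewrite linear_sum /=; apply/matrixP => i j; rewrite summxE mxE.
apply: eq_bigr => k _; rewrite linearZ /= gram_sqr !mxE (bigD1 k) //= !mxE eqxx.
rewrite big1 ?addr0; last by move=> l /negPf lk; rewrite !mxE lk mulr0.
by rewrite mulr1n /pt mulrCA mulrA.
Qed.

Lemma gram_inj F G : gram F = gram G -> F = G.
Proof. by move=> E; rewrite -(gramK F) E gramK. Qed.

Lemma sum_sqr h (U : 'M[K]_(n.+1, h)) F :
  F = \sum_i sqr U i <-> U *m U^T = gram F.
Proof.
have E : gram (\sum_i sqr U i) = U *m U^T.
  have := gram_sum U (fun=> 1); under eq_bigr do rewrite scale1r.
  move=> ->; rewrite (_ : diag_mx _ = 1%:M) ?mulmx1 //.
  by apply/matrixP => i j; rewrite !mxE.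
split=> [->|UU]; first by rewrite E.
by apply: gram_inj; rewrite E.
Qed.

Definition sqr_free h (U : 'M[K]_(n.+1, h)) : Prop :=
  forall k : 'I_h -> K, \sum_i k i *: sqr U i = 0 -> forall i, k i = 0.

Lemma sqr_freeP h (U : 'M[K]_(n.+1, h)) :
  reflect (sqr_free U) (free [tuple sqr U i | i < h]).
Proof.
apply: (iffP freeP) => H k.
  by move=> ek; apply: H; rewrite -[RHS]ek; apply: eq_bigr => i _; rewrite (nth_mktuple (sqr U)).
by move=> ek; apply: H; rewrite -[RHS]ek; apply: eq_bigr => i _; rewrite (nth_mktuple (sqr U)).
Qed.

Lemma lform_sqrZ c (u : 'I_n.+1 -> K) :
  form_pow (lform (fun i => c * u i)) 2 = c ^+ 2 *: form_pow (lform u) 2.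
Proof. by rewrite lformZ; apply: val_inj; rewrite /= exprZn. Qed.

Lemma eq_form_pow (u v : 'I_n.+1 -> K) : u =1 v ->
  form_pow (lform u) 2 = form_pow (lform v) 2.
Proof. by move/eq_lform ->. Qed.

(** A zero column has zero square, and proportional columns have proportional squares; either gives
    a linear relation. *)
Lemma sqr_free_distinct h (U : 'M[K]_(n.+1, h)) :
  sqr_free U -> distinct_points U.
Proof.
move=> fU; have nz j : exists a, U a j != 0.
  apply: contrapT => H.
  suff E : \sum_i (i == j)%:R *: sqr U i = 0.
    by have /eqP := fU _ E j; rewrite eqxx oner_eq0.
  rewrite (bigD1 j) //= big1 ?addr0 ?eqxx => [|k /negPf ->]; last by rewrite scale0r.
  rewrite scale1r /sqr (@eq_form_pow _ (fun i => 0 * 0)).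
    by rewrite lform_sqrZ expr0n scale0r.
  move=> a; rewrite mul0r; apply/eqP; apply: contrapT => /negP Ua.
  by apply: H; exists a.
split=> // i j ij; apply: contrapT => H.
have {}H a b : U a i * U b j = U b i * U a j.
  by apply/eqP; apply: contrapT => /negP ?; apply: H; exists a, b.
have [b Ub] := nz j; pose c := U b i / U b j.
have cU a : U a i = c * U a j by rewrite /c mulrAC -H mulfK.
suff E : \sum_k ((k == i)%:R - (k == j)%:R * c ^+ 2) *: sqr U k = 0.
  by have /eqP := fU _ E i; rewrite eqxx (negPf ij) mul0r subr0 oner_eq0.
under eq_bigr do rewrite scalerBl -scalerA.
rewrite sumrB (bigD1 i) //= big1 => [|k /negPf ->]; last by rewrite scale0r.
rewrite [X in _ - X](bigD1 j) //= [X in _ - (_ + X)]big1 => [|k /negPf ->]; last by rewrite scale0r.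
rewrite !eqxx !scale1r !addr0 -lform_sqrZ -(@eq_form_pow (pt U i)) ?subrr //.
Qed.

(** Square roots of the coefficients are absorbed into the linear forms, which changes neither their
    lines nor the independence of their squares. *)
Lemma polar_polyhedronP h F (Z : set (dual_proj K n)) :
  polar_polyhedron h F Z <-> exists U : 'M[K]_(n.+1, h),
    [/\ U *m U^T = gram F, sqr_free U & Z = points U].
Proof.
split=> [[L [lam [L0 -> lam0 eF fL]]]|[U [UF fU ->]]].
  have [s es] := boolp.choice (fun i => closed_sqrt (lam i)).
  have s0 i : s i != 0 by rewrite -sqrf_eq0 es.
  pose U := \matrix_(a, i) (s i * (val (L i))@_U_(a)) : 'M[K]_(n.+1, h).
  have eU i : lform (pt U i) = s i *: L i.
    rewrite -[in RHS](lformK (L i)) -lformZ; apply: eq_lform => a.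
    by rewrite /pt mxE.
  have eS i : sqr U i = lam i *: form_pow (L i) 2.
    by rewrite /sqr eU; apply: val_inj; rewrite /= exprZn es.
  exists U; split.
  - apply/sum_sqr; rewrite eF; apply: eq_bigr => i _; exact/esym.
  - move=> k; under eq_bigr do rewrite eS scalerA.
    move=> ek i; suff /eqP : k i * lam i = 0.
      by rewrite mulf_eq0 (negPf (lam0 i)) orbF => /eqP.
    move/freeP: fL => /(_ (fun i => k i * lam i)); apply.
    rewrite -[RHS]ek; apply: eq_bigr => j _.
    by rewrite (nth_mktuple (fun i => form_pow (L i) 2)).
  - by apply/seteqP; split=> x [i xi]; exists i; rewrite xi eU vline_scale.
exists (fun i => lform (pt U i)), (fun=> 1); split=> //.
- move=> i; have [/(_ i) [a Ua] _] := sqr_free_distinct fU.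
  by apply: contraNneq Ua => /lform_eq0/(_ a)/eqP.
- by move=> _; exact: oner_neq0.
- by move/sum_sqr: UF => {1}->; apply: eq_bigr => i _; rewrite scale1r.
- exact/sqr_freeP.
Qed.

Lemma VSPoP h F z : VSPo F h z <-> exists U : 'M[K]_(n.+1, h),
  [/\ U *m U^T = gram F, sqr_free U & \val z = <[plucker (ev U h)]>%VS].
Proof.
split=> [[Z [/polar_polyhedronP [U [UF fU ->]]]]|[U [UF fU zE]]].
  rewrite (hilb_point_plucker z (ev_presents (sqr_free_distinct fU) (leqnn h))) => zE.
  by exists U.
exists (points U); split; first by apply/polar_polyhedronP; exists U.
by rewrite (hilb_point_plucker z (ev_presents (sqr_free_distinct fU) (leqnn h))).
Qed.

Lemma VSPo_Hilb h (F : forms K n 2) : VSPo F h `<=` Hilb K n h.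
Proof.
move=> z [Z [/polar_polyhedronP [U [UF fU ->]] hz]].
exists (vanishing_ideal (points U)); split=> //.
exact: vanishing_length (sqr_free_distinct fU).
Qed.

Lemma sqr_free_plucker h (U : 'M[K]_(n.+1, h)) :
  sqr_free U -> plucker (ev U h) != 0.
Proof.
by move/sqr_free_distinct/ev_presents/(_ (leqnn h)) => [/plucker_neq0].
Qed.

(** Scaling column [j] by [c 0 j] scales the value of a form of degree [h] there by [c 0 j ^+ h]. So
    nonzero scalings of the columns do not move the point of the Hilbert scheme. *)
Lemma plucker_diag h (U : 'M[K]_(n.+1, h)) (c : 'rV[K]_h) :
  plucker (ev (U *m diag_mx c) h) = (\prod_i c 0 i) ^+ h *: plucker (ev U h).
Proof.
rewrite (plucker_mulmx (G := diag_mx (\row_i (c 0 i ^+ h))) (a := ev U h)).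
  rewrite det_diag; congr (_ *: _); rewrite -prodrXl.
  by apply: eq_bigr => i _; rewrite mxE.
move=> p; apply/rowP => j; rewrite evE [in RHS]mul_mx_diag evE !mxE mulrC -evalf_scale.
by apply: meval_eq => i; rewrite /pt mul_mx_diag mxE mulrC.
Qed.

Lemma sqr_free_diag h (U : 'M[K]_(n.+1, h)) (c : 'rV[K]_h) :
  (forall i, c 0 i != 0) -> sqr_free U -> sqr_free (U *m diag_mx c).
Proof.
move=> c0 fU k ek i; have c2 : c 0 i ^+ 2 != 0 by rewrite expf_neq0.
suff /eqP : k i * c 0 i ^+ 2 = 0.
  by rewrite mulf_eq0 (negPf c2) orbF => /eqP.
apply: (fU (fun i => k i * c 0 i ^+ 2)); rewrite -[RHS]ek; apply: eq_bigr => j _.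
rewrite -scalerA -lform_sqrZ; congr (_ *: _); apply: eq_form_pow => a.
by rewrite /pt mul_mx_diag mxE mulrC.
Qed.

Lemma hpoly_gram i j : hpoly 1 (fun F : forms K n 2 => gram F i j).
Proof.
have L u : hpoly 1 (fun F : forms K n 2 => evalf u F).
  by apply: hpoly_linear => c f g; rewrite linearP.
apply: eq_hpoly (hpolyZ 2%:R^-1 (hpolyD (hpolyD (L _) (hpolyN (L _)))
  (hpolyN (L _)))) => F.
by rewrite mxE.
Qed.

(** The excluded closed set is the discriminant hypersurface; [quad 1%:M], the sum of the squares of
    the variables, lies outside it. *)
Lemma general_nondegenerate (Q : forms K n 2 -> Prop) :
  (forall F, gram F \in unitmx -> Q F) -> general Q.
Proof.
move=> hQ; have [P hP eP] := hpoly_det hpoly_gram.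
exists [set F | \det (gram F) = 0]; split.
- exists [set P]; apply/seteqP; split=> F /= hF; last by rewrite -eP; exact: hF.
  by move=> P' ->; rewrite eP.
- move=> BT; have : [set: forms K n 2] (quad 1%:M) by [].
  rewrite -BT /= quadK ?trmx1 // det1 => /eqP.
  by rewrite oner_eq0.
- by move=> F /eqP dF; apply: hQ; rewrite unitmxE unitfE.
Qed.

End Quadrics.

(** * Polyhedra of arbitrary length *)

Lemma hpoly_evalf (K : closedFieldType) (V : vectType K) n h d e
    (U : V -> 'M[K]_(n.+1, h)) (p : forms K n d) j :
  hmx e U -> hpoly (d * e) (fun v => evalf (pt (U v) j) p).
Proof.
move=> hU.
apply: (@eq_hpoly _ _ _ (fun v => \sum_(m <- msupp (p : dhomog n.+1 K d)
  | m \in msupp (p : dhomog n.+1 K d))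
    (p : dhomog n.+1 K d)@_m * \prod_i (U v i j) ^+ m i)).
  by move=> v; rewrite /evalf mevalE [in RHS]big_seq.
apply: hpoly_sum => m mp; apply: hpolyZ.
have <- : mdeg m = d by exact: (dhomog_mf (dhomog_is_dhomog p)).
by rewrite mdegE big_distrl /=; apply: hpoly_prod => i; exact: hpolyX.
Qed.

Lemma hmap_plucker (K : closedFieldType) (V W : vectType K) h e
    (a : V -> 'Hom(W, 'rV[K]_h)) :
  (forall p j, hpoly e (fun v => a v p 0 j)) ->
  hmap (h * e) (fun v => plucker (a v)).
Proof.
move=> ha; apply: hmap_ffun => J.
apply: (@eq_hpoly _ _ _ (fun v =>
  \det (\matrix_(i < h, j < h) a v (vbasis {:W})`_(J i) 0 j))).
  by move=> v; rewrite ffunE.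
by apply: hpoly_det => i j; apply: eq_hpoly (ha _ j) => v; rewrite mxE.
Qed.

Section CoordRow.
Variables (K : closedFieldType) (V : vectType K) (h : nat) (X : h.-tuple V).

Definition coord_row (v : V) : 'rV[K]_h := \row_i coord X i v.

Lemma coord_row_is_linear : linear coord_row.
Proof. by move=> c p q; apply/rowP => j; rewrite !mxE linearP. Qed.

HB.instance Definition _ :=
  GRing.isLinear.Build K V 'rV[K]_h _ coord_row coord_row_is_linear.
End CoordRow.

Section AnyLength.
Variables (K : closedFieldType) (n h' : nat).
Hypothesis K0 : [pchar K] =i pred0.
Let h := h'.+1.
Variables (F : forms K n 2) (A0 : 'M[K]_(n.+1, h)).
Hypothesis uF : gram F \in unitmx.
Hypothesis A0F : A0 *m A0^T = gram F.

Let natr0 m : (m.+1%:R != 0 :> K).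
Proof. by rewrite (pcharf0P K).1. Qed.

(** A parameter is a scalar [t] followed by a flattened matrix [T]; the skew matrix is [T - T^T],
    and [t] homogenizes the Cayley transform. *)
Let V := 'rV[K]_(1 + h * h).

Let tpar (v : V) : K := v 0 0.
Let Spar (v : V) : 'M[K]_h := vec_mx (rsubmx v) - (vec_mx (rsubmx v))^T.

Let Ucay (v : V) : 'M[K]_(n.+1, h) := A0 *m cayley (tpar v) (Spar v).

Let b_sqr (U : 'M[K]_(n.+1, h)) (b : 'Hom(forms K n 2, 'rV[K]_h)) : 'M[K]_h :=
  \matrix_(i, j) b (sqr U i) 0 j.

(** The first factor makes the Cayley transform a nonzero multiple of an orthogonal matrix; the
    second certifies, through [b], that the squares of the columns are independent. *)
Let psi b (v : V) : K :=
  \det ((tpar v)%:M + Spar v) * \det (b_sqr (Ucay v) b).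

(** Independent squares are sent to the unit vectors by their coordinate map. Independence thus
    becomes an open condition, a union over [b] of nonvanishing loci. *)
Lemma sqr_free_det U :
  sqr_free U <-> exists b, \det (b_sqr U b) != 0.
Proof.
split=> [/sqr_freeP fU|[b db] k ek i].
  pose b := linfun (coord_row [tuple sqr U i | i < h]); exists b.
  suff -> : b_sqr U b = 1%:M by rewrite det1 oner_eq0.
  apply/matrixP => i j; rewrite !mxE lfunE /= mxE.
  have := coord_free i j fU; rewrite (nth_mktuple (sqr U)) => ->.
  by rewrite eq_sym.
have uB : b_sqr U b \in unitmx by rewrite unitmxE unitfE.
have : (\row_i k i) *m b_sqr U b = 0.
  apply/rowP => j; have := congr1 (fun p => b p 0 j) ek.
  rewrite linear_sum linear0 summxE => e; apply: etrans e; rewrite [LHS]mxE.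
  by apply: eq_bigr => l _; rewrite linearZ !mxE.
move/(congr1 (mulmx^~ (invmx (b_sqr U b)))); rewrite mulmxK // mul0mx.
by move/rowP/(_ i); rewrite !mxE.
Qed.

Lemma hmx_Spar : hmx 1 Spar.
Proof.
have E (i j : 'I_h) : hpoly 1 (fun v : V => vec_mx (rsubmx v) i j).
  exact: (hmx_linear (GRing.Linear.clone _ _ _ _ (vec_mx \o rsubmx) _)).
apply: hmxD => [i j|]; first exact: E.
by apply: hmxN => i j; apply: eq_hpoly (E j i) => v; rewrite [RHS]mxE.
Qed.

Let hmx_cayley (sg : bool) :
  hmx 1 (fun v => (tpar v)%:M + (-1) ^+ sg *: Spar v).
Proof.
apply: hmxD; last exact: hmxZ (hpoly_const _ _) hmx_Spar.
have ht : hpoly 1 tpar.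
  by apply: hpoly_linear => c u v; rewrite /tpar !mxE.
move=> i j; apply: eq_hpoly (hpolyZ (i == j)%:R ht) => v.
by rewrite mxE; case: (i == j); rewrite ?mul1r ?mul0r.
Qed.

Let hmx_Ucay : hmx (1 + h' * 1) Ucay.
Proof.
apply: hmxMl; apply: hmxM.
  by move=> i j; apply: eq_hpoly (hmx_cayley true i j) => v; rewrite scaleN1r.
apply: hmx_adj => i j; apply: eq_hpoly (hmx_cayley false i j) => v.
by rewrite scale1r.
Qed.

Let hpoly_psi b : hpoly (h * 1 + h * (2 * (1 + h' * 1))) (psi b).
Proof.
apply: hpolyM.
  apply: hpoly_det => i j; apply: eq_hpoly (hmx_cayley false i j) => v.
  by rewrite scale1r.
apply: hpoly_det => i j.
apply: (@eq_hpoly _ _ _ (fun v => \sum_k \sum_l b (quad (delta_mx k l)) 0 j *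
  (Ucay v k i * Ucay v l i))).
  move=> v; rewrite [RHS]mxE /sqr quad_sqr [in RHS](matrix_sum_delta (\matrix_(_, _) _)).
  rewrite !linear_sum summxE; apply: eq_bigr => k _.
  rewrite !linear_sum summxE; apply: eq_bigr => l _.
  by rewrite !linearZ [RHS]mxE [X in _ = X * _]mxE mulrC.
apply: hpoly_sum => k _; apply: hpoly_sum => l _; apply: hpolyZ.
by rewrite mulSn mul1n; apply: hpolyM; exact: hmx_Ucay.
Qed.

Let psi0 b : psi b 0 = 0.
Proof. by have := hpoly_psi b; rewrite muln1 => /hpoly_at0. Qed.

Let fpar v := plucker (ev (Ucay v) h).

Let hmap_fpar : hmap (h * (h * (1 + h' * 1))) fpar.
Proof.
apply: hmap_plucker => p j.
apply: eq_hpoly (hpoly_evalf p j hmx_Ucay) => v.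
by rewrite evE mxE.
Qed.

Let Spar_skew v : (Spar v)^T = - Spar v.
Proof. by rewrite /Spar linearB /= trmxK opprB. Qed.

Let fpar_VSPo b v : psi b v != 0 ->
  exists y, [/\ VSPo F h y, fpar v != 0 & \val y = <[fpar v]>%VS].
Proof.
rewrite mulf_eq0 negb_or => /andP[d0 db].
have fU : sqr_free (Ucay v) by apply/sqr_free_det; exists b.
have p0 : fpar v != 0 by exact: sqr_free_plucker.
exists (mkproj p0); split=> //; apply/(VSPoP K0).
set d := \det _ in d0.
have c0 : d^-1 != 0 by rewrite invr_eq0.
(* The Gram matrix of [Ucay v] is [d ^+ 2] times that of [F]; dividing every column by [d] corrects
   this and keeps the point. *)
exists (Ucay v *m diag_mx (const_mx d^-1)); split.
- rewrite diag_const_mx mul_mx_scalar linearZ /= -scalemxAl -scalemxAr scalerA.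
  rewrite /Ucay trmx_mul mulmxA -[_ *m _ *m (cayley _ _)^T]mulmxA.
  rewrite cayley_orthogonal // -/d mul_mx_scalar -scalemxAl A0F scalerA.
  by rewrite -expr2 -exprMn mulVf // expr1n scale1r.
- by apply: sqr_free_diag => // i; rewrite mxE.
- rewrite plucker_diag vline_scale // expf_neq0 //.
  by apply/prodf_neq0 => i _; rewrite mxE.
Qed.

Let VSPo_fpar y : VSPo F h y ->
  exists b v, psi b v != 0 /\ \val y = <[fpar v]>%VS.
Proof.
move/(VSPoP K0) => [U [UF fU yE]].
have [||Q QQ UQ] := @witt K (natr0 1) _ _ A0 U; [by rewrite A0F | by rewrite A0F UF |].
(* The signs make [1 + Q *m D] invertible, so that [Q *m D] is a Cayley transform; they only change
   the signs of the columns of [U]. *)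
have [s ds] := exists_signs (natr0 1) Q.
pose D := diag_mx (signs K s).
have DD : D *m D = 1%:M.
  rewrite mulmx_diag; apply/matrixP => i j; rewrite !mxE.
  by rewrite -expr2 sqrr_sign.
have DT : D^T = D by rewrite tr_diag_mx.
have [||S [sS dS cS]] := @cayley_surj K (natr0 1) h' (Q *m D).
- by rewrite trmx_mul DT mulmxA -[_ *m D *m D]mulmxA DD mulmx1.
- have -> : 1 + Q *m D = (Q + D) *m D by rewrite mulmxDl DD addrC.
  rewrite det_mulmx mulf_neq0 // det_diag; apply/prodf_neq0 => i _.
  by rewrite mxE signr_eq0.
(* [S] is halved because [Spar] subtracts the transpose, which for skew [S] doubles it. *)
pose v : V := row_mx (const_mx 1) (mxvec (2%:R^-1 *: S)).
have tv : tpar v = 1.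
  rewrite /tpar /v (_ : 0 = lshift _ 0 :> 'I_(1 + h * h)); last exact: val_inj.
  by rewrite row_mxEl mxE.
have Sv : Spar v = S.
  rewrite /Spar /v row_mxKr mxvecK linearZ /= sS scalerN opprK -mulr2n.
  by rewrite -scaler_nat scalerA mulfV ?scale1r.
pose d := \det (1%:M + S).
have UE : Ucay v = U *m diag_mx (d *: signs K s).
  have -> : diag_mx (d *: signs K s) = d *: D by rewrite linearZ.
  by rewrite /Ucay tv Sv cS UQ -!scalemxAr mulmxA.
have c0 i : (d *: signs K s) 0 i != 0 by rewrite !mxE mulf_neq0 // signr_eq0.
have /sqr_free_det [b db] : sqr_free (Ucay v) by rewrite UE; apply: sqr_free_diag.
exists b, v; split; first by rewrite /psi tv Sv mulf_neq0.
rewrite yE /fpar UE plucker_diag vline_scale // expf_neq0 //.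
by apply/prodf_neq0.
Qed.

Lemma VSP_unirational_aux : VSPo F h !=set0 ->
  irreducible (VSP F h) /\ is_unirational (VSP F h).
Proof.
move=> V0; have DX : VSPo F h `<=` VSP F h.
  by move=> z Dz; split; [exact: VSPo_Hilb Dz | exact: sub_closure].
have XD : VSP F h `<=` proj_closure (VSPo F h) by move=> z [].
split.
  exact: (irreducible_param hpoly_psi psi0 hmap_fpar fpar_VSPo VSPo_fpar V0 DX XD).
(* The parameter rows have length [1 + h * h], so the source is the projective space of dimension
   [h * h]. *)
exists (h * h)%N.
exact: (dominates_param hpoly_psi psi0 hmap_fpar fpar_VSPo VSPo_fpar V0 DX XD).
Qed.

End AnyLength.

Lemma VSPo0_VSP (K : closedFieldType) n h (F : forms K n 2) :
  ~ (VSPo F h !=set0) -> VSP F h = set0.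
Proof.
move=> V0; have -> : VSP F h = Hilb K n h `&` proj_closure (VSPo F h) by [].
suff -> : VSPo F h = set0 by rewrite closure_set0 setI0.
by apply/seteqP; split=> // z Dz; apply: V0; exists z.
Qed.

Section Component.
Variables (K : closedFieldType) (n h : nat).
Hypothesis K0 : [pchar K] =i pred0.
Variable F : forms K n 2.
Hypothesis uF : gram F \in unitmx.

Lemma component_VSPo Y : irreducible_component (VSP F h) Y -> VSPo F h !=set0.
Proof.
move=> [[[y Yy] _] YV _]; apply: contrapT => /VSPo0_VSP V0.
by move: (YV y Yy); rewrite V0.
Qed.

Lemma VSPo_unirational : VSPo F h !=set0 ->
  irreducible (VSP F h) /\ is_unirational (VSP F h).
Proof.
case: h => [|h'] V0; last first.
  by have [y /(VSPoP K0) [U [UF _ _]]] := V0; exact: VSP_unirational_aux UF V0.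
(* For [h = 0], a matrix without columns cannot have an invertible Gram matrix of size [n.+1]. *)
have [y /(VSPoP K0) [U [UF _ _]]] := V0.
by have := gram_unit_leq (A := U); rewrite UF => /(_ uF).
Qed.

Lemma component_VSP Y : irreducible_component (VSP F h) Y ->
  Y = VSP F h /\ is_unirational Y.
Proof.
move=> cY; have [iV uV] := VSPo_unirational (component_VSPo cY).
by have -> := irreducible_component_irreducible iV cY.
Qed.

End Component.

(** * Symmetric matrices and their Krylov matrices *)

Lemma mulmx_horner_eigen (K : fieldType) n (M : 'M[K]_n.+1) (w : 'rV[K]_n.+1) (c : K) q :
  w *m M = c *: w -> w *m horner_mx M q = q.[c] *: w.
Proof.
move=> wM; elim/poly_ind: q => [|q a IH].
  by rewrite rmorph0 horner0 mulmx0 scale0r.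
rewrite rmorphD rmorphM /= horner_mx_X horner_mx_C mulmxDr -mulmxE mulmxA IH.
by rewrite -scalemxAl wM scalerA mul_mx_scalar -scalerDl !hornerE.
Qed.

Section Krylov.
Variables (K : closedFieldType) (n : nat).
Hypothesis K0 : [pchar K] =i pred0.
Let N := n.+1.
Implicit Types (M : 'M[K]_N).

Definition ones : 'cV[K]_N := const_mx 1.
Definition nodes : 'rV[K]_N := \row_i (i.+1)%:R.

Definition corner M : K := (M *m ones) 0 0.

(* The powers of [corner M] make all the columns homogeneous of degree [n]. *)
Definition krylov M : 'M[K]_N :=
  \matrix_(i, j) (corner M ^+ (n - j) * (M ^+ j *m ones) i 0).

(** The coefficients carry the same powers of [corner M] as the columns of [krylov M], so that the
    value at [M], applied to [ones], is [krylov M *m c]. *)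
Definition kpoly M (c : 'cV[K]_N) : {poly K} :=
  \sum_(j < N) (c j 0 * corner M ^+ (n - j)) *: 'X^j.

Lemma kpolyE M c : horner_mx M (kpoly M c) *m ones = krylov M *m c.
Proof.
rewrite /kpoly rmorph_sum /= mulmx_suml; apply/colP => i; rewrite summxE mxE.
apply: eq_bigr => j _; rewrite horner_mxZ rmorphXn /= horner_mx_X -scalemxAl mxE.
by rewrite [X in _ = X * _]mxE; ring.
Qed.

(** By Cramer's rule, its value at [M] sends [ones] to a multiple of the [k]-th basis vector: this
    is [x_k / (x_0 + ... + x_n)] as a polynomial in [M], with the denominator [\det (krylov M)]
    cleared. *)
Definition alpha M k : {poly K} := kpoly M (col k (\adj (krylov M))).

Lemma alphaE M k :
  horner_mx M (alpha M k) *m ones = \det (krylov M) *: delta_mx k 0.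
Proof.
rewrite kpolyE colE mulmxA mul_mx_adj mul_scalar_mx.
by [].
Qed.

(* By Cramer's rule, a multiple of the characteristic polynomial of [M]. *)
Definition kchar M : {poly K} := \det (krylov M) *: 'X^N -
  kpoly M (\adj (krylov M) *m (M ^+ N *m ones)).

Lemma kcharE M : horner_mx M (kchar M) *m ones = 0.
Proof.
rewrite rmorphB /= horner_mxZ rmorphXn /= horner_mx_X mulmxBl kpolyE mulmxA mul_mx_adj.
by rewrite mul_scalar_mx -scalemxAl subrr.
Qed.

Lemma size_kpoly M c : (size (kpoly M c) <= N)%N.
Proof.
apply: (leq_trans (size_sum _ _ _)); apply/bigmax_leqP => j _.
by apply: (leq_trans (size_scale_leq _ _)); rewrite size_polyXn.
Qed.

Lemma size_kchar M : \det (krylov M) != 0 -> size (kchar M) = N.+1.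
Proof.
by move=> d0; rewrite size_polyDl size_scale ?size_polyXn // size_polyN ltnS size_kpoly.
Qed.

(** The rescaled coefficients of [q] solve a homogeneous linear system with the invertible matrix
    [krylov M]. *)
Lemma krylov_free M (q : {poly K}) : corner M != 0 -> \det (krylov M) != 0 ->
  (size q <= N)%N -> horner_mx M q *m ones = 0 -> q = 0.
Proof.
move=> t0 d0 sq q0; pose c : 'cV[K]_N := \col_j (q`_j / corner M ^+ (n - j)).
have cq : kpoly M c = q.
  rewrite -[q in RHS]coefK (poly_def (size q)) (big_ord_widen N (fun i => q`_i *: 'X^i)) //.
  rewrite big_mkcond; apply: eq_bigr => j _; rewrite mxE divfK ?expf_neq0 //.
  by case: ltnP => // /(nth_default 0) ->; rewrite scale0r.
have uK : krylov M \in unitmx by rewrite unitmxE unitfE.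
have c0 : c = 0 by rewrite -(mulKmx uK c) -kpolyE cq q0 mulmx0.
rewrite -cq c0 /kpoly big1 // => j _; by rewrite mxE mul0r scale0r.
Qed.

(* If nonzero, [ones] is a cyclic vector of [M] and the spectrum is simple. *)
Definition genericity M : K :=
  corner M * \det (krylov M) * \det (horner_mx M (kchar M)^`()).

(* [w i] is the transpose of [q i (M) ones], where [q i] is [kchar M] with its
   [i]-th linear factor removed. *)
Lemma generic_eigenbasis M : M^T = M -> genericity M != 0 ->
  exists (R : 'M[K]_N) (mu : 'rV[K]_N),
    [/\ R *m R^T = 1%:M, R *m M = diag_mx mu *m R
      & forall i, (R *m ones) i 0 != 0].
Proof.
move=> sM; rewrite /genericity !mulf_eq0 !negb_or => /andP[/andP[t0 d0] dp].
have [r er] := closed_field_poly_normal (kchar M).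
have szp := size_kchar d0.
have lc0 : lead_coef (kchar M) != 0 by rewrite lead_coef_eq0 -size_poly_eq0 szp.
have szr : size r = N.
  by move: szp; rewrite er size_scale // size_prod_XsubC => -[].
pose q (i : 'I_N) := \prod_(j < N | j != i) ('X - (r`_j)%:P).
have pq (i : 'I_N) : kchar M = lead_coef (kchar M) *: (('X - (r`_i)%:P) * q i).
  by rewrite {1}er (big_nth 0) big_mkord szr (bigD1 i).
pose w i := (horner_mx M (q i) *m ones)^T.
have w0 i : w i != 0.
  apply/eqP => /(congr1 trmx); rewrite trmxK trmx0 => /(krylov_free t0 d0).
  have sq : size (q i) = N.
    have := pq i => /(congr1 (fun p : {poly K} => size p)).
    rewrite szp size_scale // size_monicM ?monicXsubC //.
      by rewrite size_XsubC add2n => -[].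
    rewrite -size_poly_eq0 /q; apply/eqP => z; move: (pq i).
    rewrite /q; move/eqP: z; rewrite size_poly_eq0 => /eqP ->.
    by rewrite mulr0 scaler0 => z; move: szp; rewrite z size_poly0.
  by rewrite sq => /(_ (leqnn _)) z; move: sq; rewrite z size_poly0.
have wM (i : 'I_N) : w i *m M = r`_i *: w i.
  apply: trmx_inj; rewrite linearZ /= trmx_mul trmxK sM; apply/eqP.
  rewrite -subr_eq0 -mul_scalar_mx !mulmxA -!mulmxBl; apply/eqP.
  have := kcharE M; rewrite (pq i) horner_mxZ -scalemxAl => /eqP.
  rewrite scaler_eq0 (negPf lc0) /= rmorphM rmorphB /= horner_mx_X horner_mx_C.
  by rewrite -mulmxE mulmxBl => /eqP.
have qi (i : 'I_N) : (q i).[r`_i] != 0.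
  apply: contraNneq (w0 i) => qi0.
  have uP : horner_mx M (kchar M)^`() \in unitmx by rewrite unitmxE unitfE.
  rewrite -(mulmxK uP (w i)) (mulmx_horner_eigen _ (wM i)) (pq i).
  by rewrite derivZ derivM derivXsubC !hornerE /= qi0 subrr mul0r addr0 mulr0 scale0r mul0mx.
(* An eigenvector orthogonal to [ones] is orthogonal to every column of the invertible Krylov
   matrix. *)
have we i : (w i *m ones) 0 0 != 0.
  apply: contraNneq (w0 i) => we0.
  have uK : krylov M \in unitmx by rewrite unitmxE unitfE.
  rewrite -(mulmxK uK (w i)); apply/eqP.
  suff -> : w i *m krylov M = 0 by rewrite mul0mx.
  apply/rowP => j; rewrite [LHS]mxE [RHS]mxE.
  have := mulmx_horner_eigen 'X^j (wM i); rewrite rmorphXn /= horner_mx_X => E.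
  have := congr1 (fun A => corner M ^+ (n - j) * (A *m ones) 0 0) E.
  rewrite -scalemxAl [X in _ = _ * X]mxE we0 !mulr0 => z; apply: etrans z.
  rewrite -mulmxA [X in _ = _ * X]mxE mulr_sumr; apply: eq_bigr => k _.
  by rewrite [krylov _ _ _]mxE mulrCA.
have orth (i j : 'I_N) : i != j -> (w i *m (w j)^T) 0 0 = 0.
  move=> ij; have rij : r`_i - r`_j != 0.
    have := qi i; rewrite horner_prod => /prodf_neq0 /(_ j).
    by rewrite eq_sym ij !hornerE => /(_ isT).
  have E : r`_i *: (w i *m (w j)^T) = r`_j *: (w i *m (w j)^T).
    rewrite scalemxAl -wM -mulmxA scalemxAr; congr (_ *m _).
    by apply: trmx_inj; rewrite trmx_mul trmxK sM wM linearZ /= trmxK.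
  have /eqP := congr1 (fun A : 'M_1 => A 0 0) E.
  by rewrite !mxE -subr_eq0 -mulrBl mulf_eq0 (negPf rij) => /eqP.
have norm i : (w i *m (w i)^T) 0 0 != 0.
  rewrite {2}/w trmxK mulmxA (mulmx_horner_eigen _ (wM i)) -scalemxAl mxE.
  exact: mulf_neq0.
have hs i : exists s, s ^+ 2 = (w i *m (w i)^T) 0 0 by exact: closed_sqrt.
have [s es] := boolp.choice hs.
have s0 i : s i != 0 by rewrite -sqrf_eq0 es.
pose R := \matrix_i ((s i)^-1 *: w i).
have rR i : row i R = (s i)^-1 *: w i by rewrite rowK.
exists R, (\row_i r`_i); split.
- apply/matrixP => i j.
  have -> : (R *m R^T) i j = (row i R *m (row j R)^T) 0 0.
    by rewrite !mxE; apply: eq_bigr => k _; rewrite !mxE.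
  rewrite !rR linearZ /= -scalemxAl -scalemxAr scalerA [LHS]mxE [RHS]mxE.
  have [<-|ij] := eqVneq i j; last by rewrite orth ?mulr0.
  by rewrite -es -expr2 -exprMn mulVf ?expr1n.
- apply/row_matrixP => i; rewrite row_mul rR -scalemxAl wM mul_diag_mx.
  by apply/rowP => j; rewrite !mxE mulrCA.
- move=> i; have -> : (R *m ones) i 0 = (row i R *m ones) 0 0.
    by rewrite !mxE; apply: eq_bigr => k _; rewrite !mxE.
  by rewrite rR -scalemxAl mxE mulf_neq0 // invr_eq0.
Qed.

Lemma diag_ones (d : 'rV[K]_N) : diag_mx d *m ones = d^T.
Proof. by apply/colP => i; rewrite mul_diag_mx !mxE mulr1. Qed.

Lemma corner_nodes : corner (diag_mx nodes) = 1.
Proof. by rewrite /corner diag_ones !mxE. Qed.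

Lemma nodes_inj i j : nodes 0 i = nodes 0 j -> i = j.
Proof.
have inj (a b : nat) : (a <= b)%N -> a%:R = b%:R :> K -> a = b.
  move=> ab E; have := congr1 (fun x : K => x - a%:R) E.
  rewrite subrr -natrB // => /esym/eqP; rewrite ((pcharf0P K).1 K0) subn_eq0 => ba.
  by apply/eqP; rewrite eqn_leq ab.
rewrite !mxE => E; apply: val_inj; apply: succn_inj.
by case: (leqP i.+1 j.+1) => [/inj|/ltnW /inj]; [apply | move=> H; rewrite H].
Qed.

(** For the diagonal matrix of the nodes, [krylov] is a transposed Vandermonde matrix and [kchar]
    has the [N] distinct nodes as its roots. So [genericity] is not identically zero. *)
Lemma genericity_nodes : genericity (diag_mx nodes) != 0.
Proof.
set M := diag_mx nodes.
have Mq p : horner_mx M p = diag_mx (\row_i p.[nodes 0 i]).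
  rewrite horner_mx_diag; congr diag_mx; apply/rowP => i; by rewrite !mxE.
have d0 : \det (krylov M) != 0.
  have -> : krylov M = (Vandermonde N nodes)^T.
    apply/matrixP => i j; rewrite [LHS]mxE corner_nodes expr1n mul1r.
    have -> : M ^+ j = horner_mx M 'X^j by rewrite rmorphXn /= horner_mx_X.
    by rewrite Mq diag_ones !mxE hornerXn.
  rewrite det_tr det_Vandermonde; apply/prodf_neq0 => i _; apply/prodf_neq0 => j ij.
  rewrite subr_eq0; apply: contraTneq ij => /nodes_inj ->.
  by rewrite ltnn.
rewrite /genericity corner_nodes mul1r mulf_neq0 // Mq det_diag.
apply/prodf_neq0 => i _; rewrite mxE.
have rt j : root (kchar M) (nodes 0 j).
  have := kcharE M; rewrite Mq diag_ones => /colP/(_ j).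
  by rewrite [LHS]mxE [LHS]mxE [RHS]mxE /root => ->.
pose rs := [seq nodes 0 j | j <- enum 'I_N].
have urs : uniq_roots rs.
  rewrite uniq_rootsE map_inj_uniq ?enum_uniq //; exact: nodes_inj.
have E : kchar M = lead_coef (kchar M) *: \prod_(j < N) ('X - (nodes 0 j)%:P).
  rewrite [LHS](all_roots_prod_XsubC _ _ urs).
  - by rewrite big_map big_enum.
  - by rewrite size_map size_enum_ord size_kchar.
  - by apply/allP => x /mapP [j _ ->]; exact: rt.
have lc0 : lead_coef (kchar M) != 0.
  by rewrite lead_coef_eq0 -size_poly_eq0 size_kchar.
rewrite E (bigD1 i) //= derivZ derivM derivXsubC mul1r !hornerE subrr mul0r addr0.
apply: mulf_neq0 => //; rewrite horner_prod; apply/prodf_neq0 => j ji.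
by rewrite !hornerE subr_eq0; apply: contraNneq ji => /nodes_inj ->.
Qed.

Lemma hpoly_corner : hpoly 1 corner.
Proof.
by apply: hpoly_linear => c u v; rewrite /corner mulmxDl -scalemxAl !mxE.
Qed.

Lemma hmx_id : hmx 1 (fun M : 'M[K]_N => M).
Proof. by move=> i j; apply: hpoly_linear => c u v; rewrite !mxE. Qed.

Lemma hmx_pow k : hmx k (fun M : 'M[K]_N => M ^+ k).
Proof. by move=> i j; have := hmxX k hmx_id i j; rewrite muln1. Qed.

Lemma hmx_krylov : hmx n krylov.
Proof.
move=> i j; apply: (@eq_hpoly _ _ _
  (fun M => corner M ^+ (n - j) * (M ^+ j *m ones) i 0)).
  by move=> M; rewrite [RHS]mxE.
apply: (@hpoly_deg _ _ ((n - j) * 1 + j)); first by have := ltn_ord j; lia.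
by apply: hpolyM; [exact: hpolyX hpoly_corner | exact: hmxMr (hmx_pow j) i 0].
Qed.

Lemma hmx_kpoly e (c : 'M[K]_N -> 'cV[K]_N) :
  hmx e c -> hmx (e + n) (fun M => horner_mx M (kpoly M (c M))).
Proof.
move=> hc; apply: (@eq_hmx _ _ _ _ _ (fun M =>
  \sum_(j < N) (c M j 0 * corner M ^+ (n - j)) *: M ^+ j)).
  move=> M; rewrite /kpoly rmorph_sum; apply: eq_bigr => j _ /=.
  by rewrite horner_mxZ rmorphXn /= horner_mx_X.
apply: hmx_sum => j.
apply: (@hmx_deg _ _ (e + (n - j) * 1 + j)); first by have := ltn_ord j; lia.
apply: hmxZ; last exact: hmx_pow.
by apply: hpolyM; [exact: hc | exact: hpolyX hpoly_corner].
Qed.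

Lemma hmx_alpha k : hmx (n * n + n) (fun M => horner_mx M (alpha M k)).
Proof.
apply: hmx_kpoly => i j.
apply: eq_hpoly (hmx_adj hmx_krylov i k) => M.
by rewrite [RHS]mxE.
Qed.

Lemma hpoly_genericity : exists e, hpoly e.+1 genericity.
Proof.
have hd := hpoly_det hmx_krylov.
pose c M := \adj (krylov M) *m (M ^+ N *m ones).
have hc : hmx (n * n + N) c.
  by apply: hmxM; [exact: hmx_adj hmx_krylov | exact: hmxMr (hmx_pow N)].
have hp : hmx (N * n + n) (fun M => horner_mx M (kchar M)^`()).
  apply: (@eq_hmx _ _ _ _ _ (fun M => (N%:R * \det (krylov M)) *: M ^+ n +
    - \sum_(j < N) (j%:R * (c M j 0 * corner M ^+ (n - j))) *: M ^+ j.-1)).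
    move=> M; rewrite derivB derivZ derivXn rmorphB /= horner_mxZ rmorphMn rmorphXn /=.
    rewrite horner_mx_X -scaler_nat scalerA mulrC; congr (_ - _).
    rewrite /kpoly raddf_sum rmorph_sum; apply: eq_bigr => j _ /=.
    rewrite derivZ derivXn horner_mxZ rmorphMn rmorphXn /= horner_mx_X.
    by rewrite -scaler_nat scalerA mulrC.
  apply: hmxD; first by apply: hmxZ (hmx_pow n); exact: hpolyZ.
  (* The term [j = 0] is treated apart: as [0.-1 = 0], the degree count fails there, but its factor
     [j%:R] is zero. *)
  apply: hmxN; apply: hmx_sum => j; case: (posnP j) => [j0|j0].
    move=> a b; apply: eq_hpoly (hpoly0 _ _) => M.
    by rewrite j0 mul0r scale0r mxE.
  apply: (@hmx_deg _ _ (n * n + N + (n - j) * 1 + j.-1)).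
    by move: j0 (ltn_ord j); rewrite /N; lia.
  apply: hmxZ (hmx_pow _); apply: hpolyZ; apply: hpolyM; first exact: hc.
  exact: hpolyX hpoly_corner.
exists (N * n + N * (N * n + n))%N.
exact: (hpolyM (hpolyM hpoly_corner hd) (hpoly_det hp)).
Qed.

Section Quotient.
Variable B : 'M[K]_N.

Definition frame M (i : 'I_N) : {poly K} := \sum_l B i l *: alpha M l.

(** The variables become the entries of [B] applied to the polynomials [alpha M l]. This models
    evaluation at the simplex with vertices [B] times the eigenvectors of [M], and it is polynomial
    in [M] although the eigenvectors are not. *)
Definition quot M d (p : forms K n d) : 'rV[K]_N :=
  (horner_mx M (mmap (@polyC K) (frame M) (p : dhomog n.+1 K d)) *m ones)^T.

Lemma quot_is_linear M d : linear (@quot M d).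
Proof.
move=> c p q; rewrite /quot /= mmapD mmapZ rmorphD rmorphM /= horner_mx_C.
by rewrite mulmxDl linearD -mulmxE -mulmxA mul_scalar_mx linearZ.
Qed.

HB.instance Definition _ M d :=
  GRing.isLinear.Build K (forms K n d) 'rV[K]_N _ (@quot M d) (@quot_is_linear M d).

Lemma hpoly_quot d (p : forms K n d) j :
  hpoly (d * (n * n + n)) (fun M => quot M p 0 j).
Proof.
pose P := (p : dhomog n.+1 K d) : {mpoly K[n.+1]}.
have hF i : hmx (n * n + n) (fun M => horner_mx M (frame M i)).
  apply: (@eq_hmx _ _ _ _ _ (fun M => \sum_l B i l *: horner_mx M (alpha M l))).
    move=> M; rewrite rmorph_sum; apply: eq_bigr => l _ /=.
    by rewrite horner_mxZ.
  apply: hmx_sum => l; exact: (hmxZ (hpoly_const _ _) (hmx_alpha l)).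
have h1 : hmx (d * (n * n + n)) (fun M => \sum_(m <- msupp P | m \in msupp P)
    P@_m *: \prod_i horner_mx M (frame M i) ^+ m i).
  move=> a b; apply: (@eq_hpoly _ _ _ (fun M => \sum_(m <- msupp P | m \in msupp P)
    P@_m * (\prod_i horner_mx M (frame M i) ^+ m i) a b)).
    by move=> M; rewrite summxE; apply: eq_bigr => m _; rewrite mxE.
  apply: hpoly_sum => m mp; apply: hpolyZ.
  have <- : mdeg m = d by exact: (dhomog_mf (dhomog_is_dhomog p)).
  rewrite mdegE big_distrl /=.
  by apply: hmx_prod => i; exact: hmxX.
apply: eq_hpoly (hmxMr ones h1 j 0) => M; rewrite [RHS]mxE.
congr ((_ *m _) _ _); rewrite -big_seq /mmap rmorph_sum; apply: eq_bigr => m _ /=.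
rewrite rmorphM /= horner_mx_C rmorph_prod -mulmxE mul_scalar_mx.
by congr (_ *: _); apply: eq_bigr => i _; rewrite rmorphXn.
Qed.

(* On the line of the [i]-th eigenvector, [alpha M k] takes a value proportional
   to its [k]-th coordinate, so [quot] is evaluation at the eigenlines. *)
Lemma quot_eigen M (R : 'M[K]_N) (mu : 'rV[K]_N) d (p : forms K n d) :
  R *m M = diag_mx mu *m R -> (forall i, (R *m ones) i 0 != 0) ->
  quot M p *m R^T = ev (B *m R^T) d p *m
    diag_mx (\row_i ((\det (krylov M) / (R *m ones) i 0) ^+ d * (R *m ones) i 0)).
Proof.
move=> RM Re; apply/rowP => i; rewrite mul_mx_diag [RHS]mxE evE.
rewrite [X in _ = X * _]mxE [X in _ = _ * X]mxE.
set eps := (R *m ones) i 0; set D := \det _.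
have wM : row i R *m M = mu 0 i *: row i R.
  by rewrite -row_mul RM mul_diag_mx; apply/rowP => j; rewrite !mxE.
have ei q : (row i R *m horner_mx M q *m ones) 0 0 = q.[mu 0 i] * eps.
  by rewrite (mulmx_horner_eigen _ wM) -scalemxAl -row_mul mxE [X in _ * X]mxE.
have ai k : (alpha M k).[mu 0 i] = D / eps * R i k.
  apply: (mulIf (Re i)); rewrite -/eps -ei -mulmxA alphaE -scalemxAr mulrAC divfK; last exact: Re.
  by rewrite mxE -colE !mxE.
have -> : (quot M p *m R^T) 0 i =
    (row i R *m horner_mx M (mmap (@polyC K) (frame M) (p : dhomog n.+1 K d)) *m ones) 0 0.
  by rewrite /quot -trmx_mul [LHS]mxE -[in RHS]mulmxA -row_mul [RHS]mxE.
rewrite ei mulrA; congr (_ * _); rewrite mulrC -evalf_scale /evalf.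
rewrite mevalE /mmap horner_sum; apply: eq_bigr => m _.
rewrite hornerCM horner_prod; congr (_ * _); apply: eq_bigr => k _.
rewrite horner_exp; congr (_ ^+ _); rewrite horner_sum /pt mxE mulr_sumr.
by apply: eq_bigr => l _; rewrite hornerZ ai mxE mulrCA.
Qed.

End Quotient.

End Krylov.

(** * Polar simplices *)

(** Cramer's rule: the cofactors along row [j] do not involve that row. *)
Lemma det_replace_row (K : fieldType) h (X : 'M[K]_h) (s : 'rV[K]_h) j :
  \det (\matrix_(i, l) if i == j then s 0 l else X i l) = (s *m \adj X) 0 j.
Proof.
rewrite (expand_det_row _ j) mxE; apply: eq_bigr => l _.
rewrite !mxE eqxx; congr (_ * (_ * \det _)).
apply/matrixP => a b; rewrite !mxE.
by rewrite eq_sym (negPf (neq_lift _ _)).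
Qed.

Section Frames.
Variables (K : closedFieldType) (m : nat).
Hypothesis K0 : [pchar K] =i pred0.
Let n := m.+1.
Let N := n.+1.
Local Notation ones := (ones K n).
Local Notation nodes := (nodes K n).
Variables (F : forms K n 2) (B : 'M[K]_N).
Hypothesis BF : B *m B^T = gram F.
Hypothesis uF : gram F \in unitmx.

Let uB : B \in unitmx.
Proof. by move: uF; rewrite -BF unitmx_mul => /andP[]. Qed.

(** The form with coefficients [c] in the coordinates [x] adapted to the base simplex: its value at
    [B x] is [c x]. *)
Definition cform (c : 'rV[K]_N) : forms K n 1 :=
  lform (fun l => (c *m invmx B) 0 l).

Lemma cform_eval c (X : 'M[K]_N) i :
  evalf (pt (B *m X) i) (cform c) = (c *m X) 0 i.
Proof.
have -> : c *m X = (c *m invmx B) *m (B *m X) by rewrite mulmxA mulmxKV.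
by rewrite lform_eval [RHS]mxE.
Qed.

(** With [d] the row of nodes, [numer k] is [(d . x) x_k (1 . x) ^ m] and [denom j] is
    [x_j (1 . x) ^ n] in the adapted coordinates. Both have degree [m + 2 = N], the degree where the
    Plücker coordinates are taken. *)
Definition numer (k : 'I_N) : forms K n N :=
  fmul (cform nodes) (fmul (cform (delta_mx 0 k)) (form_pow (cform ones^T) m)).

Definition denom (j : 'I_N) : forms K n N :=
  fmul (cform (delta_mx 0 j)) (form_pow (cform ones^T) n).

Local Notation P := (plucker_space (forms K n N) N).

(* Up to a scalar, [M] is the multiplication by [cform nodes] / [cform ones^T] on the
   coordinate ring of the simplex: there [numer k] is the sum of the
   [M k j *: denom j], which Cramer's rule solves for [M]. *)
Definition scale_minor (y : P) : K := minor denom y.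

Definition cramer (y : P) : 'M[K]_N := \matrix_(k, j)
  minor (fun i => if i == j then numer k else denom i) y.

Lemma cramer_is_linear : linear cramer.
Proof. by move=> c y z; apply/matrixP => i j; rewrite !mxE linearP. Qed.

HB.instance Definition _ :=
  GRing.isLinear.Build K P 'M[K]_N _ cramer cramer_is_linear.

Section OneFrame.
Variable R : 'M[K]_N.
Hypothesis RR : R *m R^T = 1%:M.

Let dR : \det R^T != 0.
Proof.
rewrite det_tr; apply/eqP => z; have := congr1 determinant RR.
by rewrite det_mulmx z mul0r det1 => /esym/eqP; rewrite oner_eq0.
Qed.

Let eps i := (R *m ones) i 0.
Let X := R^T *m diag_mx (\row_i eps i ^+ n).
Let y := plucker (ev (B *m R^T) N).

Let epsE i : (ones^T *m R^T) 0 i = eps i.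
Proof. by rewrite -trmx_mul mxE. Qed.

Let deltaE k i : ((delta_mx 0 k : 'rV[K]_N) *m R^T) 0 i = R i k.
Proof. by rewrite -rowE !mxE. Qed.

Lemma denom_eval i j : evalf (pt (B *m R^T) j) (denom i) = X i j.
Proof.
have -> : evalf (pt (B *m R^T) j) (denom i) =
    evalf (pt (B *m R^T) j) (cform (delta_mx 0 i)) *
    evalf (pt (B *m R^T) j) (form_pow (cform ones^T) n) by exact: evalf_mul.
rewrite evalf_pow !cform_eval epsE deltaE /X mul_mx_diag !mxE.
by [].
Qed.

Lemma numer_eval k j : evalf (pt (B *m R^T) j) (numer k) =
  (nodes *m R^T) 0 j * (R j k * eps j ^+ m).
Proof.
have -> : evalf (pt (B *m R^T) j) (numer k) =
    evalf (pt (B *m R^T) j) (cform nodes) *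
    (evalf (pt (B *m R^T) j) (cform (delta_mx 0 k)) *
     evalf (pt (B *m R^T) j) (form_pow (cform ones^T) m)).
  by rewrite -evalf_mul; exact: evalf_mul.
by rewrite evalf_pow !cform_eval epsE deltaE.
Qed.

Lemma scale_minorE : scale_minor y = \det X.
Proof.
rewrite /scale_minor minor_plucker; congr (\det _).
by apply/matrixP => i j; rewrite mxE evE mxE denom_eval.
Qed.

Lemma scale_minor_neq0 : scale_minor y != 0 <-> forall i, eps i != 0.
Proof.
rewrite scale_minorE det_mulmx mulf_eq0 (negPf dR) det_diag.
split=> [/prodf_neq0 H i|H].
  by have := H i isT; rewrite mxE expf_eq0.
by apply/prodf_neq0 => i _; rewrite mxE expf_neq0.
Qed.

(** Let [s] be the row of values of [numer k]. The eigenvalue equation gives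
    [corner M *: s = row k (M *m X)], and [s *m \adj X] is read off by Cramer's rule. *)
Lemma cramerE M mu : M^T = M -> R *m M = diag_mx mu *m R ->
  M *m ones = corner M *: nodes^T ->
  corner M *: cramer y = scale_minor y *: M.
Proof.
move=> sM RM Me; apply/matrixP => k j; rewrite !mxE minor_plucker.
pose s := \row_l evalf (pt (B *m R^T) l) (numer k).
have -> : \matrix_(i, l) ev (B *m R^T) N (if i == j then numer k else denom i) 0 l
    = \matrix_(i, l) if i == j then s 0 l else X i l.
  apply/matrixP => i l; rewrite [LHS]mxE [RHS]mxE evE [LHS]mxE.
  by case: eqP => _; [rewrite mxE | rewrite denom_eval].
rewrite det_replace_row.
have sE : corner M *: s = row k (M *m X).
  have MR : M *m R^T = R^T *m diag_mx mu.
    by apply: trmx_inj; rewrite !trmx_mul trmxK sM RM tr_diag_mx.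
  apply/rowP => l.
  have XE : (M *m X) k l = R l k * mu 0 l * eps l ^+ n.
    rewrite /X mulmxA MR mul_mx_diag mxE mul_mx_diag [X in X * _]mxE.
    by rewrite [X in X * _ * _]mxE [X in _ * X]mxE.
  (* Entry [l] of [R *m M *m ones], computed from the nodes and from the eigenvalues. *)
  have E : corner M * (nodes *m R^T) 0 l = mu 0 l * eps l.
    have := congr1 (fun A => (R *m A) l 0) Me; rewrite mulmxA RM.
    rewrite -mulmxA mul_diag_mx mxE -/(eps l) => ->.
    rewrite -scalemxAr [RHS]mxE; congr (_ * _).
    by rewrite -[R in RHS]trmxK -trmx_mul [RHS]mxE.
  rewrite [RHS]mxE XE [LHS]mxE [s 0 l]mxE numer_eval mulrA E exprS.
  by ring.
have := congr1 (fun A => (A *m \adj X) 0 j) sE.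
rewrite -scalemxAl mxE => ->; rewrite -row_mul mxE -mulmxA mul_mx_adj.
by rewrite mul_mx_scalar mxE scale_minorE.
Qed.

(** By [quot_eigen], the two presentations differ by an invertible matrix on the right. *)
Lemma quot_plucker M mu : R *m M = diag_mx mu *m R ->
  (forall i, eps i != 0) -> \det (krylov M) != 0 ->
  exists2 c, c != 0 & y = c *: plucker (linfun (@quot K n B M N)).
Proof.
move=> RM e0 d0.
pose c := \row_i ((\det (krylov M) / eps i) ^+ N * eps i).
have c0 i : c 0 i != 0.
  rewrite mxE; apply: mulf_neq0; last exact: e0.
  by apply: expf_neq0; apply: mulf_neq0; rewrite // invr_eq0; exact: e0.
have cc : diag_mx c *m diag_mx (\row_i (c 0 i)^-1) = 1%:M.
  by rewrite mulmx_diag; apply/matrixP => i j; rewrite [in LHS]mxE [RHS]mxE mxE [X in _ * X]mxE mulfV.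
exists (\det (R^T *m diag_mx (\row_i (c 0 i)^-1))).
  rewrite det_mulmx mulf_neq0 // det_diag; apply/prodf_neq0 => i _.
  by rewrite mxE invr_eq0.
apply: plucker_mulmx => p; rewrite [in RHS]lfunE /= mulmxA (quot_eigen B p RM e0).
by rewrite -mulmxA cc mulmx1.
Qed.

(** A relation with coefficients [k] has Gram matrix [U *m diag k *m U^T = 0], where [U = B *m R^T]
    is invertible. *)
Lemma sqr_free_frame : sqr_free (B *m R^T).
Proof.
move=> k /(congr1 (@gram K n)); rewrite (gram_sum K0) linear0.
have uU : B *m R^T \in unitmx.
  rewrite unitmx_mul uB unitmx_tr; by case: (mulmx1_unit RR).
move=> E i; have : diag_mx (\row_i k i) = 0.
  rewrite -[diag_mx _](mulKmx uU) -[_ *m diag_mx _](mulmxK (_ : (B *m R^T)^T \in unitmx)).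
    by rewrite E mul0mx mulmx0.
  by rewrite unitmx_tr.
by move/matrixP/(_ i i); rewrite !mxE eqxx.
Qed.

Lemma gram_frame : (B *m R^T) *m (B *m R^T)^T = gram F.
Proof.
by rewrite trmx_mul trmxK -mulmxA [R^T *m _]mulmxA (mulmx1C RR) mul1mx BF.
Qed.

End OneFrame.

(* As the first node is 1, [M *m ones] is a multiple of the nodes exactly when
   [corner M] is the factor. *)
Definition sym_defect (M : 'M[K]_N) : 'M[K]_N := M - M^T.
Definition node_defect (M : 'M[K]_N) : 'cV[K]_N := M *m ones - corner M *: nodes^T.

Lemma sym_defect_is_linear : linear sym_defect.
Proof. by move=> c x y; apply/matrixP => i j; rewrite !mxE; ring. Qed.

Lemma node_defect_is_linear : linear node_defect.
Proof.
move=> c x y; apply/colP => i; rewrite /node_defect /corner mulmxDl -scalemxAl.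
by rewrite ![in LHS]mxE ![in RHS]mxE; ring.
Qed.

HB.instance Definition _ := GRing.isLinear.Build K 'M[K]_N 'M[K]_N _
  sym_defect sym_defect_is_linear.
HB.instance Definition _ := GRing.isLinear.Build K 'M[K]_N 'cV[K]_N _
  node_defect node_defect_is_linear.

Definition sym_space : {vspace 'M[K]_N} :=
  (lker (linfun sym_defect) :&: lker (linfun node_defect))%VS.

Lemma sym_spaceP M : reflect (M^T = M /\ M *m ones = corner M *: nodes^T)
  (M \in sym_space).
Proof.
rewrite memv_cap !memv_ker !lfunE /= !subr_eq0.
apply: (iffP andP) => [[/eqP sM /eqP nM]|[sM nM]]; first by split.
by rewrite sM nM !eqxx.
Qed.

Lemma nodes_sym_space : diag_mx nodes \in sym_space.
Proof.
apply/sym_spaceP; split; first exact: tr_diag_mx.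
by rewrite diag_ones corner_nodes scale1r.
Qed.

(** The space contains the diagonal matrix of the nodes, so its dimension is positive, of the form
    [k.+1], and its lines form a projective space of dimension [k]. *)
Lemma sym_space_coords : exists k (io : {linear 'rV[K]_k.+1 -> 'M[K]_N})
    (rho : {linear 'M[K]_N -> 'rV[K]_k.+1}),
  [/\ forall v, io v \in sym_space, forall v, rho (io v) = v
    & forall M, M \in sym_space -> io (rho M) = M].
Proof.
have [k [X bX]] : exists k (X : k.+1.-tuple 'M[K]_N), basis_of sym_space X.
  have : (0 < \dim sym_space)%N.
    rewrite lt0n dimv_eq0; apply: contraTneq nodes_sym_space => ->.
    rewrite memv0; apply: contraNneq (oner_neq0 K) => z.
    by rewrite -(corner_nodes K n) z /corner mul0mx mxE.
  have := vbasisP sym_space; move: (vbasis _).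
  by case: (\dim _) => // k X bX _; exists k, X.
pose io (v : 'rV[K]_k.+1) := \sum_i v 0 i *: X`_i.
have io_lin : linear io.
  move=> c u v; rewrite /io scaler_sumr -big_split; apply: eq_bigr => i _ /=.
  by rewrite !mxE scalerDl scalerA.
pose Io : {linear 'rV[K]_k.+1 -> 'M[K]_N} :=
  HB.pack io (GRing.isLinear.Build K _ _ *:%R io io_lin).
exists k, Io, (coord_row X); split=> [v|v|M MW] /=.
- apply: memv_suml => i _; apply: memvZ; apply: (basis_mem bX).
  by rewrite mem_nth // size_tuple.
- by apply/rowP => i; rewrite mxE coord_sum_free ?(basis_free bX).
- rewrite [RHS](coord_basis bX MW); apply: eq_bigr => i _.
  by rewrite mxE.
Qed.

(** [f] sends a symmetric matrix to the simplex of its eigenlines, transported by [B]; [g] recovers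
    the matrix by Cramer's rule. Both composites are the identity up to scalars on open sets. *)
Lemma VSP_simplices_rational : is_rational (VSP F N).
Proof.
have [k [io [rho [ioW ioK rhoK]]]] := sym_space_coords.
have [en hn] := hpoly_genericity K n.
pose f (v : 'rV[K]_k.+1) : P := plucker (linfun (@quot K n B (io v) N)).
pose g (y : P) : 'rV[K]_k.+1 := rho (cramer y).
pose psi (v : 'rV[K]_k.+1) := genericity (io v).
(* The open set of the target: the denominator in Cramer's rule is nonzero and the recovered matrix
   is generic. *)
pose phi (y : P) := scale_minor y * psi (g y).
have hio : hmap 1 io by exact: hmap_linear.
have hf : hmap (N * (N * (n * n + n) * 1)) f.
  apply: hmap_plucker => p j.
  by apply: eq_hpoly (hpoly_comp (hpoly_quot B p j) hio) => v; rewrite lfunE.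
have hg : hmap 1 g by exact: (hmap_linear (GRing.Linear.clone _ _ _ _ (rho \o cramer) _)).
have hpsi : hpoly (en.+1 * 1) psi by exact: hpoly_comp hn hio.
have hT : hpoly 1 scale_minor.
  by apply: hpoly_linear => c x y; rewrite /scale_minor linearP.
have hphi : hpoly (1 + en.+1 * 1 * 1) phi by exact: hpolyM hT (hpoly_comp hpsi hg).
have psi0 : psi 0 = 0 by move: hpsi; rewrite muln1 => /hpoly_at0.
have gZ c y : g (c *: y) = c *: g y by rewrite /g !linearZ.
(* A generic matrix gives a polar simplex, from which [g] recovers it up to a scalar. *)
have fP v : psi v != 0 -> exists z, [/\ VSPo F N z, f v != 0, \val z = <[f v]>%VS
    & scale_minor (f v) != 0 /\ exists2 c, c != 0 & g (f v) = c *: v].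
  move=> pv; have /sym_spaceP [sM Me] := ioW v.
  have [R [mu [RR RM Re]]] := generic_eigenbasis sM pv.
  move: (pv); rewrite /psi /genericity !mulf_eq0 !negb_or => /andP[/andP[t0 d0] _].
  have [c c0 yc] := quot_plucker RR RM Re d0; rewrite -/(f v) in yc.
  have yf : f v = c^-1 *: plucker (ev (B *m R^T) N).
    by rewrite yc scalerA mulVf // scale1r.
  have fR := sqr_free_frame RR.
  have f0 : f v != 0.
    have := sqr_free_plucker fR; rewrite yc; apply: contraNneq => ->.
    by rewrite scaler0.
  have T0 : scale_minor (plucker (ev (B *m R^T) N)) != 0.
    by apply/(scale_minor_neq0 RR).
  exists (mkproj f0); split=> //.
    apply/(VSPoP K0); exists (B *m R^T); split=> //; first exact: gram_frame.
    by rewrite /= yc vline_scale.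
  split.
    by rewrite yf /scale_minor linearZ; apply: mulf_neq0; rewrite ?invr_eq0.
  exists (c^-1 * (scale_minor (plucker (ev (B *m R^T) N)) / corner (io v))).
    by rewrite mulf_neq0 ?invr_eq0 // mulf_neq0 // invr_eq0.
  have E := cramerE sM RM Me.
  rewrite yf gZ -scalerA; congr (_ *: _); rewrite /g.
  have -> : cramer (plucker (ev (B *m R^T) N)) =
      (scale_minor (plucker (ev (B *m R^T) N)) / corner (io v)) *: io v.
    by rewrite mulrC -scalerA -E scalerA mulVf // scale1r.
  by rewrite linearZ /= ioK.
have yP y : VSPo F N y -> exists2 Y, \val y = <[Y]>%VS &
    phi Y != 0 -> exists c, Y = c *: f (g Y).
  move/(VSPoP K0) => [U [UF fU yE]]; exists (plucker (ev U N)) => //.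
  rewrite mulf_eq0 negb_or => /andP[T0 p0].
  pose R := (invmx B *m U)^T.
  have RR : R *m R^T = 1%:M.
    apply: mulmx1C; rewrite /R trmxK trmx_mul mulmxA -[_ *m U *m _]mulmxA UF -BF.
    by rewrite mulmxA mulVmx // mul1mx -trmx_mul mulVmx ?trmx1.
  have BR : B *m R^T = U by rewrite /R trmxK mulKVmx.
  have Re i : (R *m ones) i 0 != 0.
    by apply: (scale_minor_neq0 RR).1; rewrite BR.
  (* The eigenvalues forced by [M *m ones = nodes^T] when the eigenvectors are the rows of [R]. *)
  pose mu := \row_i ((nodes *m R^T) 0 i / (R *m ones) i 0).
  pose M := R^T *m diag_mx mu *m R.
  have RM : R *m M = diag_mx mu *m R by rewrite /M !mulmxA RR mul1mx.
  have sM : M^T = M by rewrite /M !trmx_mul trmxK tr_diag_mx mulmxA.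
  have Mo : M *m ones = nodes^T.
    have E : diag_mx mu *m (R *m ones) = R *m nodes^T.
      apply/colP => i; rewrite mul_diag_mx mxE [X in X * _]mxE divfK //.
      by rewrite -[R in RHS]trmxK -trmx_mul [RHS]mxE.
    by rewrite /M -!mulmxA E mulmxA (mulmx1C RR) mul1mx.
  have cM : corner M = 1 by rewrite /corner Mo !mxE.
  have Me : M *m ones = corner M *: nodes^T by rewrite cM scale1r.
  have := cramerE sM RM Me; rewrite cM scale1r BR; set Y := plucker _ in T0 p0 *.
  move=> GY; have YW : cramer Y \in sym_space.
    by rewrite GY memvZ //; apply/sym_spaceP.
  have igY : io (g Y) = scale_minor Y *: M by rewrite /g rhoK.
  have RM' : R *m io (g Y) = diag_mx (scale_minor Y *: mu) *m R.
    by rewrite igY -scalemxAr RM linearZ /= scalemxAl.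
  move: p0; rewrite /psi /genericity !mulf_eq0 !negb_or => /andP[/andP[_ d0] _].
  have [c _ yc] := quot_plucker RR RM' Re d0.
  by exists c; rewrite -yc BR.
have M0 := nodes_sym_space.
pose v0 := rho (diag_mx nodes).
have pv0 : psi v0 != 0 by rewrite /psi /v0 rhoK // genericity_nodes.
have neq0 v : psi v != 0 -> v != 0 by apply: contraNneq => ->; rewrite psi0.
have phi_f v : psi v != 0 -> phi (f v) != 0.
  move=> pv; have [_ [_ _ _ [T0 [c c0 gc]]]] := fP v pv.
  by rewrite /phi gc mulf_neq0 // (hpoly_scale hpsi) mulf_neq0 // expf_neq0.
(* The identity of [f \o g] up to scalars passes from the polar simplices to their closure, because
   proportionality is a closed condition. *)
have closeP Y y : VSP F N y -> Y \in \val y -> phi Y != 0 -> exists c, Y = c *: f (g Y).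
  move=> [_ clY] Yy pY.
  have [y' [_ f0 _ _]] : exists z, [/\ VSPo F N z, f (g Y) != 0, \val z = <[f (g Y)]>%VS
    & scale_minor (f (g Y)) != 0 /\ exists2 c, c != 0 & g (f (g Y)) = c *: g Y].
    by apply: fP; move: pY; rewrite mulf_eq0 negb_or => /andP[].
  (* The 2 by 2 minors of the pair [f (g Z)], [Z]; the factor [phi Z] makes them vanish also at the
     polar simplices outside the open set. *)
  pose chi (JJ : {ffun 'I_N -> 'I_(\dim {:forms K n N})} *
      {ffun 'I_N -> 'I_(\dim {:forms K n N})}) (Z : P) : K :=
    phi Z * (f (g Z) JJ.1 * Z JJ.2 - f (g Z) JJ.2 * Z JJ.1).
  have hcoord J : hpoly 1 (fun Z : P => Z J).
    by apply: hpoly_linear => c x z; rewrite !ffunE.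
  have hfg J : hpoly (1 * (N * (N * (n * n + n) * 1)) * 1) (fun Z : P => f (g Z) J).
    exact: hpoly_comp (hpoly_comp (hcoord J) hf) hg.
  have [ec hchi] : exists ec, forall JJ, hpoly ec (chi JJ).
    eexists => JJ; apply: eq_hpoly (hpolyM hphi (hpolyD
      (hpolyM (hfg JJ.1) (hcoord JJ.2)) (hpolyN (hpolyM (hfg JJ.2) (hcoord JJ.1))))) => Z.
    by [].
  have chi0 : zeros chi y.
    apply: clY; first exact: proj_closed_zeros hchi.
    move=> z /yP [Z zZ ZP] JJ w; rewrite zZ => /vlineP [c ->].
    rewrite (hpoly_scale (hchi JJ)) /chi; have [->|/ZP [d Zd]] := eqVneq (phi Z) 0.
      by rewrite mul0r mulr0.
    have ZJ J : Z J = d * f (g Z) J by rewrite {1}Zd ffunE.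
    by rewrite !ZJ; ring.
  have [J fJ] : exists J, f (g Y) J != 0.
    apply: contrapT => H; move/eqP: f0; apply; apply/ffunP => J; rewrite [RHS]ffunE.
    by apply/eqP; apply: contrapT => /negP ?; apply: H; exists J.
  exists (Y J / f (g Y) J); apply/ffunP => J'; rewrite ffunE.
  have /eqP := chi0 (J, J') Y Yy; rewrite /chi mulf_eq0 (negPf pY) /= subr_eq0 => /eqP E.
  apply: (mulfI fJ); rewrite E /GRing.scale /=.
  by field.
have [rf erf] := hmap_ratmap hf; have [rg erg] := hmap_ratmap hg.
have cA : proj_closed (zeros (fun _ : unit => psi)).
  exact: (proj_closed_zeros (d := fun=> _) (fun=> hpsi)).
have cB : proj_closed (zeros (fun _ : unit => phi)).
  exact: (proj_closed_zeros (d := fun=> _) (fun=> hphi)).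
have VV : VSPo F N `<=` VSP F N.
  by move=> z Dz; split; [exact: (VSPo_Hilb K0 Dz) | exact: sub_closure].
exists k, rf, rg, (zeros (fun _ : unit => psi)), (zeros (fun _ : unit => phi)); split.
- split=> // /(_ (mkproj (neq0 _ pv0)) I).
  by apply: (@in_zeros _ _ _ _ _ v0 tt); rewrite //= memv_line.
- split=> // sub; have [z [Vz f0 ez _]] := fP v0 pv0.
  move: (sub z (VV z Vz)).
  by apply: (@in_zeros _ _ _ _ _ (f v0) tt); [rewrite ez memv_line | exact: phi_f].
- move=> x _ /notin_zeros [_ [v vx pv]].
  have [z [Vz f0 ez [T0 [c c0 gc]]]] := fP v pv.
  exists z; split.
  + exact: VV.
  + by apply: (@in_zeros _ _ _ _ _ (f v) tt); [rewrite ez memv_line | exact: phi_f].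
  + by exists v; rewrite erf ez memv_line.
  + exists (f v); rewrite erg ez memv_line gc memvZ //; split=> //.
    by rewrite scaler_eq0 negb_or c0 neq0.
- move=> y Vy /notin_zeros [_ [Y Yy pY]].
  have [c Yc] := closeP Y y Vy Yy pY.
  have pg : psi (g Y) != 0 by move: pY; rewrite mulf_eq0 negb_or => /andP[].
  have [z [_ f0 _ _]] := fP _ pg.
  have Y0 : Y != 0.
    apply: contraNneq pY => ->; rewrite /phi /scale_minor linear0.
    by rewrite mul0r.
  have c0 : c != 0 by apply: contraNneq Y0 => c0; rewrite Yc c0 scale0r.
  exists (mkproj (neq0 _ pg)); split=> //.
  + by apply: (@in_zeros _ _ _ _ _ (g Y) tt); rewrite //= memv_line.
  + by exists Y; rewrite erg memv_line neq0.
  + exists (g Y); rewrite erf memv_line f0; split=> //.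
    have -> : f (g Y) = c^-1 *: Y by rewrite {2}Yc scalerA mulVf // scale1r.
    exact: memvZ.
Qed.

End Frames.

Theorem theorem1 (R : realType) (n : nat) (hn : (1 <= n)%N) :
  general (fun F : forms R[i] n 2 =>
    (forall (h : nat) (Y : set (proj (hilb_space R[i] n h))),
        irreducible_component (VSP F h) Y -> is_unirational Y) /\
    (forall Y : set (proj (hilb_space R[i] n n.+1)),
        irreducible_component (VSP F n.+1) Y -> is_rational Y)).
Proof.
have K0 : [pchar R[i]] =i pred0 by exact: Num.Theory.pchar_num.
apply: (general_nondegenerate K0) => F uF; split=> [h Y|].
  by case/(component_VSP K0 uF).
case: n hn F uF => // m _ F uF Y cY.
(* A component is nonempty, so a polar simplex exists; it serves as the base simplex [B]. *)
have [y /(VSPoP K0) [B [BF _ _]]] := component_VSPo cY.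
have [-> _] := component_VSP K0 uF cY.
exact: (VSP_simplices_rational K0 BF uF).
Qed.
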